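(* Let $A$ be an $n$-LNakayama algebra, let $D$ be its Dyck path and let $E=\mathrm{LK}(D)$ be the image of $D$ under the Lalanne–Kreweras involution. Then for $0\le i\le n-2$: (1) $S_i$ is $1$-regular if and only if $E$ has a $1$-cut at position $i$; (2) $S_i$ is $2$-regular if and only if $E$ has a $2$-hill at position $i$.
   Context: Fix a field $\mathbb{F}$. An $n$-LNakayama algebra is $A=\mathbb{F}Q/I$ with $Q$ the linear quiver $0\to1\to\cdots\to n-1$ and $I$ admissible ($J^m\subseteq I\subseteq J^2$, $m\ge2$, $J$ the arrow ideal). Modules are finite-dimensional right modules; $S_i$ is the simple module at vertex $i$; Kupisch series $c_i=\dim_{\mathbb{F}} e_iA$. A simple module $S$ is $k$-regular if $\operatorname{pd}(S)=k$, $\operatorname{Ext}^i_A(S,A)=0$ for $0\le i<k$ and $\dim_{\mathbb{F}}\operatorname{Ext}^k_A(S,A)=1$. Lattice paths use horizontal steps $(x,y)\to(x,y+1)$ and vertical steps $(x,y)\to(x+1,y)$. A Dyck path of semilength $N$ goes from $(0,0)$ to $(N,N)$ staying in $y\ge x$; its area sequence is $c_k=h_k-k+1$ ($0\le k\le N$), $h_k$ the largest $y$ with $(k,y)$ on the path. The Dyck path of $A$ is the Dyck path of semilength $n-1$ whose area sequence is the Kupisch series of $A$. A double rise with midpoint $(x,y)$: consecutive horizontal steps $(x,y-1)\to(x,y)\to(x,y+1)$; a double fall with midpoint $(x,y)$: consecutive vertical steps $(x-1,y)\to(x,y)\to(x+1,y)$. A valley at $(x,y)$ is a vertical step ending at $(x,y)$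 immediately followed by a horizontal step. Lalanne–Kreweras involution: if $r_1<\dots<r_m$ are the $y$-coordinates of the midpoints of the double rises of $D$ and $f_1<\dots<f_m$ the $x$-coordinates of the midpoints of its double falls (there are equally many), then $\mathrm{LK}(D)$ is the unique Dyck path of the same semilength whose valleys are exactly $(r_t,f_t)$, $1\le t\le m$. A $1$-cut at position $i$ is the occurrence in the path of a horizontal step with $x$-coordinate $i$ (a step $(i,y)\to(i,y+1)$) and of a vertical step with $y$-coordinate $i+1$ (a step $(x,i+1)\to(x+1,i+1)$). A $2$-hill at position $i$ is a segment of the path consisting of the steps $(i,i)\to(i,i+1)\to(i,i+2)\to(i+1,i+2)\to(i+2,i+2)$. *)

(* Defs.v *)
From HB Require Import structures.
From mathcomp Require Import all_boot all_order all_algebra all_field.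

Set Implicit Arguments.
Unset Strict Implicit.
Unset Printing Implicit Defensive.

Import GRing.Theory.
Local Open Scope ring_scope.

(* For quivers and Dyck paths, N : nat stands for n - 1: the linear quiver     *)
(* 0 -> 1 -> ... -> N has n = N.+1 vertices, and the Dyck paths have           *)
(* semilength N.                                                               *)

(* A path of the linear quiver is determined by its source and its target. *)
Definition lpath (N : nat) := {p : 'I_N.+1 * 'I_N.+1 | (p.1 <= p.2)%N}.

HB.instance Definition _ N := Finite.on (lpath N).

Definition psrc N (p : lpath N) : 'I_N.+1 := (val p).1.
Definition ptgt N (p : lpath N) : 'I_N.+1 := (val p).2.
Definition plength N (p : lpath N) : nat := (ptgt p - psrc p)%N.

(* p is the concatenation "q, then r"; paths are read from left to right, so *)
(* that e_i A is spanned by the paths starting at i.                         *)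
Definition is_concat N (q r p : lpath N) : bool :=
  [&& ptgt q == psrc r, psrc p == psrc q & ptgt p == ptgt r].

(* The path algebra: the vector space on the set of paths. The alias hides the *)
(* pointwise product of {ffun _ -> _}.                                         *)
Definition pathalg (F : fieldType) (N : nat) : Type := {ffun lpath N -> F^o}.

HB.instance Definition _ (F : fieldType) (N : nat) :=
  Vector.copy (pathalg F N) {ffun lpath N -> F^o}.

Section PathAlgebra.

Variables (F : fieldType) (N : nat).
Implicit Types f g h : pathalg F N.

Definition pbasis (p : lpath N) : pathalg F N := [ffun q => (q == p)%:R].

Definition pmul f g : pathalg F N :=
  [ffun p => \sum_(qr : lpath N * lpath N | is_concat qr.1 qr.2 p)
               f qr.1 * g qr.2].

Definition pone : pathalg F N := [ffun p => (psrc p == ptgt p)%:R].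

Definition pcoef f (i j : 'I_N.+1) : F :=
  if insub (i, j) is Some p then f p else 0.

Lemma pcoef_path f (p : lpath N) : pcoef f (psrc p) (ptgt p) = f p.
Proof. by rewrite /pcoef /psrc /ptgt -surjective_pairing valK. Qed.

Lemma pcoef_out f (i j : 'I_N.+1) : ~~ (i <= j)%N -> pcoef f i j = 0.
Proof. by move=> ij; rewrite /pcoef insubN. Qed.

Lemma pmulE f g p :
  pmul f g p = \sum_k pcoef f (psrc p) k * pcoef g k (ptgt p).
Proof.
rewrite ffunE (bigID (fun k : 'I_N.+1 => (psrc p <= k <= ptgt p)%N)) /=.
rewrite [X in _ = _ + X]big1 ?addr0; last first.
  by move=> k; rewrite negb_and => /orP[] /pcoef_out->; rewrite ?mul0r ?mulr0.
rewrite (partition_big (fun qr : lpath N * lpath N => ptgt qr.1)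
  (fun k => (psrc p <= k <= ptgt p)%N)) /=; last first.
  move=> [q r] /= /and3P[/eqP qr /eqP -> /eqP ->]; rewrite {2}qr.
  by rewrite (valP q) (valP r).
apply: eq_bigr => k /andP[pk kp].
pose q : lpath N := exist _ (psrc p, k) pk.
pose r : lpath N := exist _ (k, ptgt p) kp.
rewrite (big_pred1 (q, r)) => [|[q' r']] /=.
  by rewrite -(pcoef_path f q) -(pcoef_path g r).
rewrite /is_concat xpair_eqE -!val_eqE /= [val q']surjective_pairing.
rewrite [val r']surjective_pairing !xpair_eqE -/(psrc q') -/(ptgt q').
rewrite -/(psrc r') -/(ptgt r') !val_eqE.
apply/idP/idP => [/andP[/and3P[/eqP <- /eqP -> /eqP ->] /eqP ->]|].
  by rewrite !eqxx.
by move=> /andP[/andP[/eqP -> /eqP ->] /andP[/eqP -> /eqP ->]]; rewrite !eqxx.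
Qed.

Lemma pcoefM f g i j : pcoef (pmul f g) i j = \sum_k pcoef f i k * pcoef g k j.
Proof.
have [ij|ij] := boolP (i <= j)%N.
  pose p : lpath N := exist _ (i, j) ij.
  by rewrite -[LHS]/(pcoef _ (psrc p) (ptgt p)) pcoef_path pmulE.
rewrite pcoef_out // big1 // => k _.
have [ik|/pcoef_out->] := boolP (i <= k)%N; last by rewrite mul0r.
have [kj|/pcoef_out->] := boolP (k <= j)%N; last by rewrite mulr0.
by rewrite (leq_trans ik kj) in ij.
Qed.

Lemma pcoef1 i j : pcoef pone i j = (i == j)%:R.
Proof.
have [ij|ij] := boolP (i <= j)%N.
  pose p : lpath N := exist _ (i, j) ij.
  by rewrite -[LHS]/(pcoef _ (psrc p) (ptgt p)) pcoef_path ffunE.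
by rewrite pcoef_out //; case: eqP ij => // ->; rewrite leqnn.
Qed.

Lemma pcoefP f g : (forall i j, pcoef f i j = pcoef g i j) -> f = g.
Proof. by move=> fg; apply/ffunP => p; rewrite -!pcoef_path. Qed.

Fact pmulA : associative pmul.
Proof.
move=> f g h; apply: pcoefP => i j; rewrite !pcoefM.
under eq_bigr => k _ do rewrite pcoefM mulr_sumr.
rewrite exchange_big /=; apply: eq_bigr => k _.
by rewrite pcoefM mulr_suml; apply: eq_bigr => l _; rewrite mulrA.
Qed.

Fact pmul1 : left_id pone pmul.
Proof.
move=> f; apply: pcoefP => i j; rewrite pcoefM (bigD1 i) //= pcoef1 eqxx mul1r.
by rewrite big1 ?addr0 // => k ki; rewrite pcoef1 eq_sym (negbTE ki) mul0r.
Qed.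

Fact pmulr1 : right_id pone pmul.
Proof.
move=> f; apply: pcoefP => i j; rewrite pcoefM (bigD1 j) //= pcoef1 eqxx mulr1.
by rewrite big1 ?addr0 // => k kj; rewrite pcoef1 (negbTE kj) mulr0.
Qed.

Fact pmulPl a f g h : pmul (a *: f + g) h = a *: pmul f h + pmul g h.
Proof.
apply/ffunP => p; rewrite !ffunE scaler_sumr -big_split /=.
by apply: eq_bigr => qr _; rewrite !ffunE mulrDl scalerAl.
Qed.

Fact pmulPr a f g h : pmul h (a *: f + g) = a *: pmul h f + pmul h g.
Proof.
apply/ffunP => p; rewrite !ffunE scaler_sumr -big_split /=.
by apply: eq_bigr => qr _; rewrite !ffunE mulrDr scalerAr.
Qed.

Fact pmulDl : left_distributive pmul +%R.
Proof. by move=> f g h; rewrite -[f]scale1r pmulPl !scale1r. Qed.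

Fact pmulDr : right_distributive pmul +%R.
Proof. by move=> h f g; rewrite -[f]scale1r pmulPr !scale1r. Qed.

Fact pone_neq0 : pone != 0.
Proof.
apply/eqP => /ffunP/(_ (exist _ (ord0, ord0) (leqnn 0))).
by rewrite !ffunE eqxx => /eqP; rewrite oner_eq0.
Qed.

HB.instance Definition _ := GRing.Zmodule_isNzRing.Build (pathalg F N)
  pmulA pmul1 pmulr1 pmulDl pmulDr pone_neq0.

Fact pscaleAl (a : F) f g : a *: (f * g) = (a *: f) * g.
Proof.
have := pmulPl a f 0 g.
by rewrite (mul0r g : pmul 0 g = 0) !addr0.
Qed.

HB.instance Definition _ :=
  GRing.Lmodule_isLalgebra.Build F (pathalg F N) pscaleAl.

Fact pscaleAr (a : F) f g : a *: (f * g) = f * (a *: g).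
Proof.
have := pmulPr a g 0 f.
by rewrite (mulr0 f : pmul f 0 = 0) !addr0.
Qed.

HB.instance Definition _ :=
  GRing.Lalgebra_isAlgebra.Build F (pathalg F N) pscaleAr.

HB.instance Definition _ := Algebra_isFalgebra.Build F (pathalg F N).

End PathAlgebra.

Definition vertex F N (i : 'I_N.+1) : pathalg F N :=
  pbasis F (exist _ (i, i) (leqnn i)).

Definition arrows F N : seq (pathalg F N) :=
  [seq pbasis F p | p <- enum [pred p : lpath N | plength p == 1%N]].

(* The two-sided ideal generated by the arrows. *)
Definition arrow_ideal F N : {vspace pathalg F N} :=
  ({:pathalg F N} * <<arrows F N>> * {:pathalg F N})%VS.

Definition admissible F N (I : {vspace pathalg F N}) : Prop :=
  exists2 m, (2 <= m)%N &
    (arrow_ideal F N ^+ m <= I)%VS /\ (I <= arrow_ideal F N ^+ 2)%VS.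

(* A quotient FQ/I is given by a surjective algebra morphism from FQ with *)
(* kernel I.                                                              *)
Record lnakayama (F : fieldType) (N : nat) := LNakayama {
  lnak_alg :> falgType F;
  lnak_proj : 'AHom(pathalg F N, lnak_alg);
  lnak_surj : limg lnak_proj = fullv;
  lnak_admissible : admissible (lker lnak_proj)
}.

Definition idem F N (A : lnakayama F N) (i : 'I_N.+1) : A :=
  lnak_proj A (vertex F i).

Definition kupisch F N (A : lnakayama F N) (i : 'I_N.+1) : nat :=
  \dim (<[idem A i]> * {:A})%VS.

Section Modules.

Variables (F : fieldType) (A : falgType F).

(* Finite-dimensional right modules. *)
Record rmodule := RModule {
  rm_space :> vectType F;
  rm_act : rm_space -> A -> rm_space;
  rm_act_linearl : forall a, linear (fun v => rm_act v a);
  rm_act_linearr : forall v, linear (rm_act v);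
  rm_act1 : forall v, rm_act v 1 = v;
  rm_actM : forall v a b, rm_act v (a * b) = rm_act (rm_act v a) b
}.

Implicit Types M N P Q : rmodule.

Definition regular_rmodule : rmodule :=
  @RModule A (fun v a => v * a)
    (fun a k u v =>
       etrans (mulrDl (k *: u) v a) (congr1 (+%R^~ (v * a)) (esym (scalerAl k u a))))
    (fun v k a b =>
       etrans (mulrDr v (k *: a) b) (congr1 (+%R^~ (v * b)) (esym (scalerAr k v a))))
    (@mulr1 A) (@mulrA A).

Definition simple_rmodule M : Prop :=
  \dim {:M} <> 0%N /\
  forall U : {vspace M}, (forall u a, u \in U -> rm_act u a \in U) ->
    U = 0%VS \/ U = fullv.

Definition ract M (a : A) : 'End(M) := linfun (fun v => rm_act v a).

Lemma ractE M a v : ract M a v = rm_act v a.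
Proof.
pose L := GRing.isLinear.Build F M M *:%R (fun v => rm_act v a)
  (@rm_act_linearl M a).
pose f : {linear M -> M} := HB.pack (fun v => rm_act v a) L.
exact: (lfunE f).
Qed.

Definition intertwine M N (a : A) (f : 'Hom(M, N)) : 'Hom(M, N) :=
  ((f \o ract M a) - (ract N a \o f))%VF.

Fact intertwine_is_linear M N a : linear (@intertwine M N a).
Proof.
move=> k f g; rewrite /intertwine comp_lfunDl comp_lfunDr -comp_lfunZl.
by rewrite -comp_lfunZr scalerBr opprD addrACA.
Qed.

HB.instance Definition _ M N a := GRing.isLinear.Build F 'Hom(M, N) 'Hom(M, N)
  *:%R (@intertwine M N a) (@intertwine_is_linear M N a).

(* The F-space Hom_A(M, N); see homAP. *)
Definition homA M N : {vspace 'Hom(M, N)} :=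
  (\bigcap_(i < \dim {:A}) lker (linfun (@intertwine M N (vbasis {:A})`_i)))%VS.

Lemma homAP M N (f : 'Hom(M, N)) :
  f \in homA M N <-> forall v a, f (rm_act v a) = rm_act (f v) a.
Proof.
have mem_ker a : (f \in lker (linfun (@intertwine M N a))) <->
    forall v, f (rm_act v a) = rm_act (f v) a.
  rewrite memv_ker lfunE /= /intertwine; split.
    move/eqP => f0 v; apply/eqP; rewrite -subr_eq0; apply/eqP.
    move/lfunP: f0 => /(_ v).
    by rewrite add_lfunE opp_lfunE !comp_lfunE !ractE lfunE /= => ->.
  move=> fa; apply/eqP/lfunP => v.
  by rewrite add_lfunE opp_lfunE !comp_lfunE !ractE fa subrr lfunE.
split=> [|fa]; last first.
  rewrite memvE; apply/subv_bigcapP => i _; rewrite -memvE.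
  by apply/mem_ker => v; apply: fa.
rewrite memvE => /subv_bigcapP fi v a.
have lin (W : rmodule) (w : W) : rm_act w a =
    \sum_(i < \dim {:A}) coord (vbasis {:A}) i a *: @rm_act W w (vbasis {:A})`_i.
  pose L := GRing.isLinear.Build F A W *:%R (@rm_act W w)
    (@rm_act_linearr W w).
  pose h : {linear A -> W} := HB.pack (@rm_act W w) L.
  rewrite -[rm_act w a]/(h a) {1}(coord_vbasis (memvf a)) linear_sum.
  by apply: eq_bigr => i _; rewrite linearZ.
rewrite !lin linear_sum; apply: eq_bigr => i _; rewrite linearZ /=.
congr (_ *: _); have := fi i isT; rewrite -memvE => /mem_ker; exact.
Qed.

(* Projectivity in the category of finite-dimensional right modules. *)
Definition projective P : Prop :=
  forall (M N : rmodule) (g : 'Hom(M, N)) (f : 'Hom(P, N)),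
    g \in homA M N -> limg g = fullv -> f \in homA P N ->
    exists2 h : 'Hom(P, M), h \in homA P M & (g \o h)%VF = f.

Record presolution M := PResolution {
  pr_mod : nat -> rmodule;
  pr_diff : forall k, 'Hom(pr_mod k.+1, pr_mod k);
  pr_aug : 'Hom(pr_mod 0%N, M);
  pr_projective : forall k, projective (pr_mod k);
  pr_diff_hom : forall k, pr_diff k \in homA (pr_mod k.+1) (pr_mod k);
  pr_aug_hom : pr_aug \in homA (pr_mod 0%N) M;
  pr_aug_surj : limg pr_aug = fullv;
  pr_exact0 : lker pr_aug = limg (pr_diff 0%N);
  pr_exact : forall k, lker (pr_diff k) = limg (pr_diff k.+1)
}.

Definition precomp P Q N (d : 'Hom(P, Q)) : 'Hom('Hom(Q, N), 'Hom(P, N)) :=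
  linfun (fun f : 'Hom(Q, N) => (f \o d)%VF).

Lemma precompE P Q N (d : 'Hom(P, Q)) (f : 'Hom(Q, N)) :
  precomp N d f = (f \o d)%VF.
Proof.
have lin : linear (fun f : 'Hom(Q, N) => (f \o d)%VF).
  by move=> k g h; rewrite comp_lfunDl -comp_lfunZl.
pose L := GRing.isLinear.Build F 'Hom(Q, N) 'Hom(P, N) *:%R _ lin.
pose c : {linear 'Hom(Q, N) -> 'Hom(P, N)} :=
  HB.pack (fun f : 'Hom(Q, N) => (f \o d)%VF) L.
exact: (lfunE c).
Qed.

(* The cochain complex Hom_A(P_0, N) -> Hom_A(P_1, N) -> ... *)
Definition cocycles M (R : presolution M) (N : rmodule) (k : nat) :
    {vspace 'Hom(pr_mod R k, N)} :=
  (homA (pr_mod R k) N :&: lker (precomp N (pr_diff R k)))%VS.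

Definition coboundaries M (R : presolution M) (N : rmodule) (k : nat) :
    {vspace 'Hom(pr_mod R k, N)} :=
  match k with
  | 0 => 0%VS
  | j.+1 => (precomp N (pr_diff R j) @: homA (pr_mod R j) N)%VS
  end.

(* dim Ext^k_A(M, N) = d, where Ext^k_A(M, N) is the k-th cohomology of the   *)
(* complex above; it does not depend on the resolution. The subtraction is    *)
(* exact because the coboundaries form a subspace of the cocycles.            *)
Definition ext_dim_eq M (N : rmodule) (k d : nat) : Prop :=
  exists R : presolution M,
    (\dim (cocycles R N k) - \dim (coboundaries R N k))%N = d.

Definition pd_le M (k : nat) : Prop :=
  exists R : presolution M, forall j, (k < j)%N -> \dim {:pr_mod R j} = 0%N.

Definition pd_eq M (k : nat) : Prop :=
  pd_le M k /\ forall j, (j < k)%N -> ~ pd_le M j.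

Definition k_regular (k : nat) (S : rmodule) : Prop :=
  [/\ simple_rmodule S,
      pd_eq S k,
      forall i, (i < k)%N -> ext_dim_eq S regular_rmodule i 0
    & ext_dim_eq S regular_rmodule k 1].

End Modules.

(* S is (a copy of) the simple module at vertex i: S is simple, S e_i <> 0. *)
Definition simple_at F N (A : lnakayama F N) (i : 'I_N.+1) (S : rmodule A) :
    Prop :=
  simple_rmodule S /\ exists v : S, rm_act v (idem A i) <> 0.

Local Open Scope nat_scope.

(* Lattice paths starting at (0, 0): true is a horizontal step, from (x, y) to *)
(* (x, y.+1); false is a vertical step, from (x, y) to (x.+1, y).              *)
Definition lattice_path := seq bool.

Notation hstep := true (only parsing).
Notation vstep := false (only parsing).

Definition position (w : lattice_path) (j : nat) : nat * nat :=
  (count_mem vstep (take j w), count_mem hstep (take j w)).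

Definition dyck (N : nat) (w : lattice_path) : Prop :=
  [/\ size w = N + N,
      position w (size w) = (N, N)
    & forall j, j <= size w -> (position w j).1 <= (position w j).2].

Definition height (w : lattice_path) (k : nat) : nat :=
  \max_(j < (size w).+1 | (position w j).1 == k) (position w j).2.

(* On Dyck paths height w k >= k, so that the subtraction is exact. *)
Definition area (w : lattice_path) (k : nat) : nat := height w k - k + 1.

(* The points where a step a is immediately followed by a step b, in the order *)
(* in which the path visits them.                                              *)
Definition turns (a b : bool) (w : lattice_path) : seq (nat * nat) :=
  [seq position w j.+1 | j <- iota 0 (size w).-1 &
    (nth vstep w j == a) && (nth vstep w j.+1 == b)].

Definition double_rises := turns hstep hstep.
Definition double_falls := turns vstep vstep.
Definition valleys := turns vstep hstep.

(* E is the image of D under the Lalanne-Kreweras involution. The lists r and f *)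
(* are increasing since midpoints are listed along the path.                    *)
Definition is_LK (N : nat) (D E : lattice_path) : Prop :=
  let r := [seq p.2 | p <- double_rises D] in
  let f := [seq p.1 | p <- double_falls D] in
  dyck N E /\ valleys E =i zip r f.

Definition has_step (s : bool) (w : lattice_path) (x y : nat) : Prop :=
  exists j, [/\ j < size w, nth vstep w j = s & position w j = (x, y)].

Definition has_1cut (w : lattice_path) (i : nat) : Prop :=
  (exists y, has_step hstep w i y) /\ (exists x, has_step vstep w x i.+1).

Definition has_2hill (w : lattice_path) (i : nat) : Prop :=
  exists j, position w j = (i, i) /\
    take 4 (drop j w) = [:: hstep; hstep; vstep; vstep].

Definition is_dyck_path_of F N (A : lnakayama F N) (D : lattice_path) : Prop :=
  dyck N D /\ forall k : 'I_N.+1, area D k = kupisch A k.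

(* Main.v *)
Require Import Defs.
From HB Require Import structures.
From mathcomp Require Import all_boot all_order all_algebra all_field zify.

(** Write [u a b] for the image in [A] of the path from [a] to [b]. The ideal
    of relations is spanned by paths, so [u a b] is nonzero exactly when
    [a <= b < g a], where [g a] is the sum of [a] and the Kupisch number [c_a];
    hence [g a] is one more than the height of [D] at [a]. With [a_0 = i],
    [a_1 = i + 1] and [a_(k+2) = g a_k], left multiplication by the
    [u a_k a_(k+1)] makes the right ideals [e_(a_k) A] into a projective
    resolution of [S_i]. Computing [Ext] with it, [S_i] is 1-regular iff
    [g i = g (i + 1)] and [g] omits the value [i + 1], and 2-regular iff
    [g i = i + 2], [g (i + 1) <> g i], [g (i + 2) = g (i + 1)] and [g] omits
    the value [i + 1].

    On the other side, the double rises of [D] are at the ordinates that are no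
    heights, and its double falls at the abscissas where the height does not
    change. A cut of [LK D] only depends on these two sets. A hill of [LK D]
    is delimited by two valleys on the diagonal, i.e. by double rises and
    double falls with the same coordinate and the same rank; ranks are
    controlled by the fact that the number of distinct heights up to [h k] is
    one more than the number of jumps of [h] up to [k]. *)

Set Implicit Arguments.
Unset Strict Implicit.
Unset Printing Implicit Defensive.

(** * Lattice paths *)

Section LatticePaths.

Implicit Types (w : lattice_path) (a b : bool) (j k x y : nat).

Definition steps a w j : nat := count_mem a (take j w).

Lemma positionE w j : position w j = (steps false w j, steps true w j).
Proof. by []. Qed.

Lemma stepsS a w j :
  j < size w -> steps a w j.+1 = steps a w j + (nth false w j == a).
Proof.
move=> jw; rewrite /steps (take_nth false) // -cats1 count_cat /=.
by rewrite addn0.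
Qed.

Lemma steps_sum w j : j <= size w -> steps false w j + steps true w j = j.
Proof.
move=> jw; rewrite -[RHS](size_takel jw) -(count_predC (pred1 false)).
by congr (_ + _); apply: eq_count => -[].
Qed.

Lemma steps_mono a w j k : j <= k -> steps a w j <= steps a w k.
Proof.
move=> jk; rewrite /steps -[take k w](cat_take_drop j) count_cat.
by rewrite take_takel // leq_addr.
Qed.

Lemma steps_reach a w n : n < steps a w (size w) ->
  exists j, [/\ j < size w, nth false w j = a & steps a w j = n].
Proof.
move=> nw; have ex : exists m, n < steps a w m by exists (size w).
case: (ex_minnP ex) => -[|m]; first by rewrite /steps take0.
move=> nm minm; have mw : m < size w by apply: minm.
have mn : steps a w m <= n by rewrite leqNgt; apply/negP => /minm; rewrite ltnn.
move: nm; rewrite (stepsS a mw); exists m; split=> //; last by lia.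
by apply/eqP; move: nm; case: eqP; lia.
Qed.

Lemma turnsP a b w p : reflect
  (exists j, [/\ j.+1 < size w, nth false w j = a, nth false w j.+1 = b
    & p = position w j.+1]) (p \in turns a b w).
Proof.
apply: (iffP mapP) => [[j + ->]|[j [jw wj wj1 ->]]].
  rewrite mem_filter mem_iota => /andP[/andP[/eqP wj /eqP wj1] jw].
  by exists j; split=> //; lia.
by exists j => //; rewrite mem_filter mem_iota wj wj1 !eqxx /=; lia.
Qed.

Lemma turns_sorted a w :
  sorted ltn [seq (if a then p.2 else p.1) | p <- turns a a w].
Proof.
rewrite -map_comp (eq_map (g := fun j => steps a w j.+1)); last by case: (a).
set s := filter _ _; have sP : all (mem s) s by apply/allP.
apply: (homo_sorted_in _ sP); last first.
  by apply: sorted_filter (iota_ltn_sorted _ _); apply: ltn_trans.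
move=> j k _; rewrite !inE mem_filter mem_iota => /andP[/andP[ka _] kw] jk.
rewrite /= (@stepsS a w k); last by lia.
by rewrite ka addn1 ltnS steps_mono.
Qed.

(** Abscissas never decrease, and after this vertical step they exceed [steps false w j]; the
    maximum in [height] is therefore reached just before it. *)
Lemma height_vstep w j : j < size w -> nth false w j = false ->
  height w (steps false w j) = steps true w j.
Proof.
move=> jw wj; apply/eqP; rewrite eqn_leq; apply/andP; split; last first.
  have jw' : j < (size w).+1 by apply: ltnW.
  by apply: (bigmax_sup (Ordinal jw')); rewrite positionE /=.
apply/bigmax_leqP => k; rewrite positionE /= => /eqP xk.
apply: steps_mono; rewrite leqNgt; apply/negP => jk.
by have := steps_mono false w jk; rewrite (stepsS _ jw) wj xk; lia.
Qed.

(** * Dyck paths: heights, double rises and falls, steps on a line, hills *)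

Section Dyck.

Variables (N : nat) (w : lattice_path).
Hypothesis wN : dyck N w.

Lemma dyck_size : size w = N + N. Proof. by case: wN. Qed.

Lemma dyck_steps a : steps a w (size w) = N.
Proof. by case: wN => _ [xN yN] _; case: a. Qed.

Lemma dyck_steps_le a j : steps a w j <= N.
Proof.
have [jw|jw] := leqP j (size w); last first.
  by rewrite /steps take_oversize -?(dyck_steps a) /steps ?take_size // ltnW.
by rewrite -(dyck_steps a) steps_mono.
Qed.

Lemma dyck_le j : j <= size w -> steps false w j <= steps true w j.
Proof. by case: wN => _ _; apply. Qed.

(** The index of a step is the sum of the coordinates of its starting point; this locates the
    vertical step that leaves abscissa [k]. *)
Lemma height_step k : k < N ->
  [/\ k + height w k < size w, nth false w (k + height w k) = false,
      steps false w (k + height w k) = k &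
      steps true w (k + height w k) = height w k].
Proof.
rewrite -{1}(dyck_steps false) => /steps_reach[j [jw wj <-]].
by rewrite height_vstep // steps_sum // ltnW.
Qed.

(** The path reaches ordinate [y] by a horizontal step. The step after it is either horizontal,
    which makes a double rise, or vertical, and then [y] is a height. *)
Lemma double_risesP y :
  y \in [seq p.2 | p <- double_rises w] <->
  0 < y < N /\ forall k, k < N -> height w k <> y.
Proof.
split=> [/mapP[_ /turnsP[j [jw wj wj1 ->]] ->]|[/andP[y0 yN] hy]].
  rewrite positionE /=; have jw' := ltnW jw.
  have yE := stepsS true jw'; rewrite wj eqxx in yE.
  have y1E := stepsS true jw; rewrite wj1 eqxx in y1E.
  have := dyck_steps_le true j.+2; split; first by lia.
  move=> k /height_step[kw wk xk yk] hk; rewrite {}hk in kw wk xk yk.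
  have [jk|kj|jk] := ltngtP j.+1 (k + steps true w j.+1).
  - by have := steps_mono true w jk; lia.
  - by have := @steps_mono true w (k + steps true w j.+1) j; lia.
  by rewrite -jk wj1 in wk.
have y1 : y.-1 < steps true w (size w) by rewrite dyck_steps; lia.
have [j [jw wj yj]] := steps_reach y1.
have yE := stepsS true jw; rewrite wj eqxx yj in yE.
have jw1 : j.+1 < size w.
  rewrite ltn_neqAle jw andbT; apply/eqP => jE.
  by have := dyck_steps true; rewrite -jE; lia.
apply/mapP; exists (position w j.+1); last by rewrite positionE /=; lia.
apply/turnsP; exists j; split=> //; case wj1: (nth false w j.+1) => //.
have := stepsS false jw1; rewrite wj1 eqxx => xE.
have := dyck_steps_le false j.+2; rewrite xE addn1 => /hy.
by rewrite height_vstep //; lia.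
Qed.

(** The vertical steps leaving [x.-1] and [x] are consecutive exactly when both are made at the same
    ordinate. *)
Lemma double_fallsP x :
  x \in [seq p.1 | p <- double_falls w] <->
  0 < x < N /\ height w x = height w x.-1.
Proof.
split=> [/mapP[_ /turnsP[j [jw wj wj1 ->]] ->]|[/andP[x0 xN] hx]].
  rewrite positionE /=; have jw' := ltnW jw.
  have xE := stepsS false jw'; rewrite wj eqxx in xE.
  have x1E := stepsS false jw; rewrite wj1 eqxx in x1E.
  have yE := stepsS true jw'; rewrite wj addn0 in yE.
  have := dyck_steps_le false j.+2; split; first by lia.
  by rewrite height_vstep // xE addn1 /= height_vstep.
have x1N : x.-1 < N by lia.
have [jw wj xj yj] := height_step x1N.
have [jw' wj' xj' yj'] := height_step xN; rewrite hx in jw' wj' xj' yj'.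
have jE : x + height w x.-1 = (x.-1 + height w x.-1).+1 by lia.
rewrite jE in jw' wj' xj'.
apply/mapP; exists (position w (x.-1 + height w x.-1).+1).
  by apply/turnsP; exists (x.-1 + height w x.-1).
by rewrite positionE /= xj'.
Qed.

Lemma dyck_hstep0 : 0 < N -> nth false w 0 = true.
Proof.
move=> N0; have w0 : 0 < size w by rewrite dyck_size; lia.
have := dyck_le w0; rewrite !stepsS // /steps !take0.
by case: (nth false w 0).
Qed.

(** For [x > 0] the first horizontal step at abscissa [x] follows the vertical step that reaches
    [x], which gives a valley; at [x = 0] a Dyck path starts horizontally. *)
Lemma hstep_at x : x < N ->
  (exists y, has_step true w x y) <-> x = 0 \/ exists y, (x, y) \in valleys w.
Proof.
move=> xN; split=> [[y [j [jw wj]]]|[->|[y /turnsP[j [jw _ wj1 xy]]]]].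
- rewrite positionE => -[xj _]; case: x => [|x] in xN xj *; first by left.
  right; have xw : x < steps false w (size w) by rewrite dyck_steps; lia.
  have [k [kw wk xk]] := steps_reach xw.
  have xE := stepsS false kw; rewrite wk eqxx xk in xE.
  have kj : k < j by rewrite ltnNge; apply/negP => /(steps_mono false w); lia.
  have kw1 : k.+1 < size w by apply: leq_ltn_trans jw.
  exists (steps true w k.+1); apply/turnsP; exists k; split=> //; last first.
    by rewrite positionE xE addn1.
  have [kjE|kj1] := eqVneq k.+1 j; first by rewrite kjE.
  apply/negPn/negP => /negbTE wk1; have := stepsS false kw1.
  rewrite wk1 eqxx; have : k.+2 <= j by lia.
  by move/(steps_mono false w); lia.
- have w0 : 0 < size w by rewrite dyck_size; lia.
  by exists 0, 0; rewrite dyck_hstep0 ?positionE /steps ?take0 //; lia.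
by exists y, j.+1; rewrite -xy.
Qed.

(** Mirror image of [hstep_at]: here the last vertical step at ordinate [y] counts, and at [y = N]
    it is the last step of the path. *)
Lemma vstep_at y : 0 < y <= N ->
  (exists x, has_step false w x y) <-> y = N \/ exists x, (x, y) \in valleys w.
Proof.
move=> /andP[y0 yN]; split=> [[x [j [jw wj]]]|[yE|[x /turnsP[j [jw wj wj1 xy]]]]].
- rewrite positionE => -[_ yj]; have [->|yN'] := eqVneq y N; first by left.
  right; have yw : y < steps true w (size w) by rewrite dyck_steps; lia.
  have [k [kw wk yk]] := steps_reach yw.
  have yE := stepsS true kw; rewrite wk eqxx yk in yE.
  have kj : j < k.
    rewrite ltnNge leq_eqVlt; apply/negP => /orP[/eqP kj|]; first by rewrite kj wj in wk.
    by move/(steps_mono true w); lia.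
  case: k => // k in kw wk yk yE kj *.
  have yk' := @stepsS true w k (ltnW kw).
  have := @steps_mono true w j k kj => yjk.
  exists (steps false w k.+1); apply/turnsP; exists k; split=> //.
    by move: yk'; case: (nth false w k) => //=; lia.
  by rewrite positionE yk.
- have w0 : (size w).-1 < size w by rewrite dyck_size; lia.
  have wE : (size w).-1.+1 = size w by lia.
  exists (steps false w (size w).-1), (size w).-1; rewrite w0 positionE.
  have := dyck_le (ltnW w0); have := stepsS true w0; have := stepsS false w0.
  rewrite !wE !dyck_steps.
  case: (nth false w _) => /=; first by lia.
  by move=> *; split=> //; congr (_, _); lia.
have jw' := ltnW jw.
exists (steps false w j), j; split=> //.
have := stepsS true jw'; rewrite wj addn0; move: xy; rewrite !positionE.
by case=> _ -> ->.
Qed.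

(** Between the diagonal points [(i, i)] and [(i.+2, i.+2)] a Dyck path is either the hill or the
    zigzag with a valley at abscissa [i.+1]. Away from its ends, a Dyck path meets the diagonal in
    valleys only. *)
Lemma hill_at i : i < N -> has_2hill w i <->
  [/\ i = 0 \/ (i, i) \in valleys w,
      i.+2 = N \/ (i.+2, i.+2) \in valleys w
    & forall y, (i.+1, y) \notin valleys w].
Proof.
move=> iN; split.
  case=> j [xy hill].
  have jw : j + 4 <= size w.
    have := congr1 size hill; rewrite size_take size_drop /=; case: ifP; lia.
  have st k : k < 4 ->
      nth false w (k + j) = nth false [:: true; true; false; false] k.
    by move=> k4; rewrite -hill nth_take // nth_drop addnC.
  have s0 : nth false w j = true := st 0 isT.
  have s1 : nth false w j.+1 = true := st 1 isT.
  have s2 : nth false w j.+2 = false := st 2 isT.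
  have s3 : nth false w j.+3 = false := st 3 isT.
  move: xy; rewrite positionE => -[x0 y0].
  have E a : [/\ steps a w j.+1 = steps a w j + (true == a),
     steps a w j.+2 = steps a w j.+1 + (true == a),
     steps a w j.+3 = steps a w j.+2 + (false == a) &
     steps a w j.+4 = steps a w j.+3 + (false == a)].
    by split; rewrite [LHS]stepsS ?s0 ?s1 ?s2 ?s3 //; lia.
  have [x1 x2 x3 x4] := E false; have [y1 y2 y3 y4] := E true.
  rewrite /= in x1 x2 x3 x4 y1 y2 y3 y4.
  split.
  - case: j => [|j] in jw s0 x0 y0 {hill st s1 s2 s3 E x1 x2 x3 x4 y1 y2 y3 y4} *.
      by left; rewrite -x0 /steps take0.
    right; apply/turnsP; exists j; rewrite positionE x0 y0; split=> //; first by lia.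
    have jw1 : j < size w by lia.
    have := dyck_le (ltnW jw1); have := stepsS true jw1; have := stepsS false jw1.
    by rewrite x0 y0; case: (nth false w j) => //=; lia.
  - have [jE|jE] := eqVneq (j + 4) (size w).
      left; have := dyck_steps true; rewrite -jE addn4; lia.
    right; apply/turnsP; exists j.+3; rewrite s3.
    have jw1 : j.+4 < size w by lia.
    split=> //; last by rewrite positionE; congr (_, _); lia.
    have := dyck_le jw1; have := stepsS true jw1; have := stepsS false jw1.
    by case: (nth false w j.+4) => //=; lia.
  move=> y; apply/turnsP => -[k [kw wk wk1]]; rewrite positionE => -[xk _].
  have [kj|jk] := leqP k.+1 j.+2; first by have := steps_mono false w kj; lia.
  have [jk'|kj] := leqP j.+4 k.+1; first by have := steps_mono false w jk'; lia.
  have kE : k.+1 = j.+3 by lia.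
  by rewrite kE s3 in wk1.
case=> hi hi2 nov.
have i2N : i.+2 <= N.
  case: hi2 => [->//|/turnsP[k [_ _ _ -[-> _]]]].
  exact: dyck_steps_le.
have wE := dyck_size.
have [x0 y0] : steps false w (i + i) = i /\ steps true w (i + i) = i.
  case: hi => [->|/turnsP[k [kw _ _]]]; first by rewrite /steps take0.
  rewrite positionE => -[xk yk].
  by have := steps_sum (ltnW kw); rewrite -xk -yk => ->.
have [x4 y4] : steps false w (i + i).+4 = i.+2 /\ steps true w (i + i).+4 = i.+2.
  have i4 : (i + i).+4 = i.+2 + i.+2 by lia.
  case: hi2 => [iE|/turnsP[k [kw _ _]]]; first by rewrite i4 iE -wE !dyck_steps.
  rewrite positionE => -[xk yk].
  by have := steps_sum (ltnW kw); rewrite i4 -xk -yk => ->.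
have sw k : k < 4 -> (i + i + k) < size w by lia.
have s0 := sw 0 isT; have s1 := sw 1 isT; have s2 := sw 2 isT; have s3 := sw 3 isT.
rewrite addn0 addn1 addn2 addn3 in s0 s1 s2 s3.
exists (i + i); rewrite positionE x0 y0; split=> //.
have drE : take 4 (drop (i + i) w) = [:: nth false w (i + i);
    nth false w (i + i).+1; nth false w (i + i).+2; nth false w (i + i).+3].
  by rewrite (drop_nth false s0) (drop_nth false s1) (drop_nth false s2)
    (drop_nth false s3) /= take0.
have nv : ~ (nth false w (i + i).+1 = false /\ nth false w (i + i).+2 = true /\
    steps false w (i + i).+2 = i.+1).
  case=> w1 [w2 x2]; have /negP := nov (steps true w (i + i).+2); apply.
  by apply/turnsP; exists (i + i).+1; rewrite positionE x2.
have := dyck_le s0; have := dyck_le s2; have := dyck_le (ltnW s3); move: nv.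
have := stepsS false s0; have := stepsS false s1.
have := stepsS false s2; have := stepsS false s3.
have := stepsS true s0; have := stepsS true s1.
have := stepsS true s2; have := stepsS true s3.
rewrite drE; move: (nth false w (i + i)) (nth false w (i + i).+1).
move: (nth false w (i + i).+2) (nth false w (i + i).+3).
rewrite x0 y0 x4 y4.
(* Of the sixteen words of length four, the end points and the Dyck condition leave two, and [nv]
   excludes the zigzag. *)
by case; case; case; case => //=; lia.
Qed.

End Dyck.

End LatticePaths.

(** * The Lalanne-Kreweras involution *)

Lemma mem_unzip1_zip (S T : eqType) (s : seq S) (t : seq T) x :
  size s <= size t -> x \in s -> exists y, (x, y) \in zip s t.
Proof.
move=> st; rewrite -{1}(unzip1_zip st) => /mapP[[x' y] xy ->].
by exists y.
Qed.

Lemma mem_unzip2_zip (S T : eqType) (s : seq S) (t : seq T) y :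
  size t <= size s -> y \in t -> exists x, (x, y) \in zip s t.
Proof.
move=> ts; rewrite -{1}(unzip2_zip ts) => /mapP[[x y'] xy ->].
by exists x.
Qed.

Lemma mem_zip_index (S T : eqType) (s : seq S) (t : seq T) x y :
    uniq s -> uniq t -> size s = size t ->
  ((x, y) \in zip s t) = [&& x \in s, y \in t & index x s == index y t].
Proof.
move=> + + st; move: s t st; apply: seq_ind2 => //= x' y' s t st IH.
case/andP=> x's us /andP[y't ut]; rewrite !inE xpair_eqE IH //.
rewrite [x' == x]eq_sym [y' == y]eq_sym.
have [->|xx] := eqVneq x x'; have [->|yy] := eqVneq y y' => //=.
- by rewrite (negbTE x's) andbF.
- by rewrite (negbTE y't) !andbF.
Qed.

Lemma index_filter_iota (P : pred nat) m n : P m -> 0 < m <= n ->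
  index m [seq x <- iota 1 n | P x] = count P (iota 1 m.-1).
Proof.
move=> Pm /andP[m0 mn]; have -> : n = m.-1 + (n - m).+1 by lia.
rewrite iotaD /= add1n prednK // filter_cat index_cat /= Pm /= eqxx addn0.
rewrite mem_filter mem_iota (_ : m < 1 + m.-1 = false) ?andbF ?size_filter //.
by lia.
Qed.

(** * Ranks of rises and falls computed from a height function *)

Section Counting.

Variables (N : nat) (h : nat -> nat).
Hypothesis h_mono : forall k l, k <= l -> h k <= h l.
Hypothesis h_gt : forall k, k < N -> k < h k.
Hypotheses (N_gt0 : 0 < N) (h_pred : h N.-1 = N) (h_last : h N = N).

Definition is_value y : bool := y \in [seq h k | k <- iota 0 N].

Lemma is_valueP y : reflect (exists2 k, k < N & h k = y) (is_value y).
Proof.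
apply: (iffP mapP) => -[k].
  by rewrite mem_iota => kN ->; exists k.
by move=> kN <-; exists k => //; rewrite mem_iota.
Qed.

Definition values_le m : nat := count is_value (iota 1 m).
Definition jumps_le m : nat := count (fun x => h x != h x.-1) (iota 1 m).

Lemma values_le_next a b : a < b -> is_value b ->
  (forall y, a < y < b -> ~~ is_value y) -> values_le b = (values_le a).+1.
Proof.
move=> ab vb novalue; have -> : b = (a + (b - a).-1 + 1) by lia.
rewrite /values_le !iotaD !count_cat /= -addnA -[in RHS]addn1; congr (_ + _).
rewrite (_ : count _ (iota (1 + a) _) = 0).
  by rewrite (_ : 1 + _ = b) ?vb; lia.
apply/eqP; rewrite -leqn0 leqNgt -has_count; apply/hasPn => y.
by rewrite mem_iota => yb; apply: novalue; lia.
Qed.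

Lemma values_leS m : values_le m.+1 = values_le m + is_value m.+1.
Proof. by rewrite /values_le -[in LHS](addn1 m) iotaD count_cat /= addn0 add1n. Qed.

Lemma jumps_leS m : jumps_le m.+1 = jumps_le m + (h m.+1 != h m).
Proof. by rewrite /jumps_le -[in LHS](addn1 m) iotaD count_cat /= addn0 add1n. Qed.

(** Each jump of [h] adds exactly one value, since no value lies strictly between [h k] and
    [h k.+1]; the extra one is the smallest value [h 0]. *)
Lemma values_le_jumps k : k < N -> values_le (h k) = (jumps_le k).+1.
Proof.
elim: k => [|k IH] kN.
  rewrite (@values_le_next 0) ?h_gt //; first by apply/is_valueP; exists 0.
  move=> y /andP[_ yh]; apply/is_valueP => -[k _ hk].
  by have := h_mono (leq0n k); lia.
rewrite jumps_leS; have [->|hne] := eqVneq (h k.+1) (h k).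
  by rewrite addn0 IH // ltnW.
have hlt : h k < h k.+1 by have := h_mono (leqnSn k); lia.
rewrite (@values_le_next (h k)) ?IH ?addn1 //; first exact: ltnW.
  by apply/is_valueP; exists k.+1.
move=> y /andP[ky yk]; apply/is_valueP => -[l _ hl].
have [lk|kl] := leqP l k; first by have := h_mono lk; lia.
by have := h_mono kl; lia.
Qed.

Definition rises : seq nat := [seq y <- iota 1 N.-1 | ~~ is_value y].
Definition falls : seq nat := [seq x <- iota 1 N.-1 | h x == h x.-1].

Lemma mem_rises y : y \in rises = (0 < y < N) && ~~ is_value y.
Proof. by rewrite mem_filter mem_iota add1n prednK // andbC. Qed.

Lemma mem_falls x : x \in falls = (0 < x < N) && (h x == h x.-1).
Proof. by rewrite mem_filter mem_iota add1n prednK // andbC. Qed.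

Lemma count_nonvalues m :
  count (fun y => ~~ is_value y) (iota 1 m) = m - values_le m.
Proof.
rewrite -[X in X - _](size_iota 1 m) -(count_predC is_value).
by rewrite addKn.
Qed.

Lemma count_nonjumps m :
  count (fun x => h x == h x.-1) (iota 1 m) = m - jumps_le m.
Proof.
rewrite -[X in X - _](size_iota 1 m).
rewrite -(count_predC (fun x => h x != h x.-1)) addKn.
by apply: eq_count => x /=; rewrite negbK.
Qed.

(** Up to [N.-1] there are as many values as jumps: take [k = N.-1] in [values_le_jumps] and discard
    the value [N] itself. *)
Lemma size_rises_falls : size rises = size falls.
Proof.
rewrite !size_filter count_nonvalues count_nonjumps.
have N1 : N.-1 < N by lia.
have := values_le_jumps N1; rewrite h_pred.
have -> : N = N.-1.+1 by lia.
rewrite values_leS prednK //.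
rewrite (_ : is_value N) ?addn1 => [[->] //|].
by apply/is_valueP; exists N.-1.
Qed.

Lemma values_le_le m : values_le m <= m.
Proof. by have := count_size is_value (iota 1 m); rewrite size_iota. Qed.

Lemma jumps_le_le m : jumps_le m <= m.
Proof.
by have := count_size (fun x => h x != h x.-1) (iota 1 m); rewrite size_iota.
Qed.

(** The zip pairs elements of equal rank, and the rank of [m] counts the non-values, respectively
    the non-jumps, below [m]. As [m] is neither a value nor a jump, equal ranks mean equal counts up
    to [m]. *)
Lemma diag_rises_falls m : (m, m) \in zip rises falls <->
  [/\ 0 < m < N, ~~ is_value m, h m = h m.-1 & values_le m = jumps_le m].
Proof.
rewrite mem_zip_index ?filter_uniq ?iota_uniq ?size_rises_falls //.
rewrite mem_rises mem_falls.
have idx : 0 < m < N -> ~~ is_value m -> h m == h m.-1 ->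
    (index m rises == index m falls) = (values_le m == jumps_le m).
  move=> mN vm hm; rewrite !index_filter_iota //; [|lia..].
  rewrite count_nonvalues count_nonjumps.
  have := values_leS m.-1; have := jumps_leS m.-1; rewrite prednK; last by lia.
  rewrite (negbTE vm) hm !addn0 => -> ->.
  have := values_le_le m.-1; have := jumps_le_le m.-1; lia.
split=> [/and3P[/andP[mN vm] /andP[_ hm]]|[mN vm /eqP hm /eqP]].
  by rewrite idx // => /eqP vj; split=> //; apply/eqP.
by rewrite mN vm hm idx.
Qed.

Section Paths.

Variables (D E : lattice_path).
Hypotheses (DN : dyck N D) (hD : forall k, k < N -> height D k = h k).
Hypothesis (hE : is_LK N D E).

(** A strictly increasing list is determined by its members, so the coordinates of the double rises
    and double falls of [D] are the lists [rises] and [falls], ranks included. *)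
Lemma valleys_LK : valleys E =i zip rises falls.
Proof.
case: hE => _ EV p; rewrite EV; congr (p \in zip _ _).
  apply: (irr_sorted_eq ltn_trans ltnn); first exact: (turns_sorted true).
    by apply: sorted_filter (iota_ltn_sorted _ _); apply: ltn_trans.
  move=> y; rewrite mem_rises; apply/idP/idP.
    case/(double_risesP DN) => -> noh; apply/is_valueP => -[k kN hk].
    by apply: (noh k kN); rewrite hD.
  case/andP=> yN /is_valueP noh; apply/(double_risesP DN); split=> // k kN hk.
  by apply: noh; exists k; rewrite -?hD.
apply: (irr_sorted_eq ltn_trans ltnn); first exact: (turns_sorted false).
  by apply: sorted_filter (iota_ltn_sorted _ _); apply: ltn_trans.
move=> x; rewrite mem_falls; apply/idP/idP.
  by case/(double_fallsP DN) => xN; rewrite xN !hD; [move/eqP | lia..].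
case/andP=> xN /eqP hx; apply/(double_fallsP DN); split=> //.
by rewrite !hD; [| lia..].
Qed.

Lemma valley_x x : (exists y, (x, y) \in valleys E) <-> x \in rises.
Proof.
split=> [[y]|xr].
  rewrite valleys_LK => /(map_f fst).
  by rewrite -/(unzip1 _) unzip1_zip ?size_rises_falls.
have [|y xy] := @mem_unzip1_zip _ _ rises falls x _ xr.
  by rewrite size_rises_falls.
by exists y; rewrite valleys_LK.
Qed.

Lemma valley_y y : (exists x, (x, y) \in valleys E) <-> y \in falls.
Proof.
split=> [[x]|yf].
  rewrite valleys_LK => /(map_f snd).
  by rewrite -/(unzip2 _) unzip2_zip ?size_rises_falls.
have [|x xy] := @mem_unzip2_zip _ _ rises falls y _ yf.
  by rewrite size_rises_falls.
by exists x; rewrite valleys_LK.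
Qed.

Let EN : dyck N E. Proof. by case: hE. Qed.

(** The boundary cases of [hstep_at] and [vstep_at] agree with the general formula: [0] is never a
    value because [h k > k], and [i.+1 = N] forces [h i = h i.+1 = N]. *)
Lemma cut_LK i : i < N ->
  has_1cut E i <-> h i = h i.+1 /\ forall k, k < N -> h k <> i.
Proof.
move=> iN; rewrite /has_1cut (hstep_at EN iN) (vstep_at EN (y := i.+1)) //.
rewrite valley_x valley_y mem_rises mem_falls /=; split=> [[ir jf]|[hi noi]].
  split.
    case: jf => [iE|/andP[_ /eqP //]].
    by rewrite iE h_last (_ : i = N.-1) //; lia.
  move=> k kN hk; case: ir => [i0|/andP[_ /is_valueP]].
    by have := h_gt kN; lia.
  by apply; exists k.
split.
  have [->|i0] := eqVneq i 0; [by left|right].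
  by rewrite lt0n i0 iN; apply/is_valueP => -[k kN]; apply: noi.
have [->|iN'] := eqVneq i.+1 N; [by left|right].
by rewrite ltn_neqAle iN' iN hi eqxx.
Qed.

Lemma hill_LK i : i < N ->
  has_2hill E i <->
  [/\ h i = i.+1, forall k, k < N -> h k <> i, h i.+1 <> h i
    & h i.+2 = h i.+1].
Proof.
move=> iN; rewrite (hill_at EN iN) !valleys_LK.
have novalE : (forall y, (i.+1, y) \notin valleys E) <-> i.+1 \notin rises.
  split=> [nov|/negP ir y].
    by apply/negP => /valley_x[y]; apply/negP.
  by apply/negP => iy; apply: ir; apply/valley_x; exists y.
rewrite mem_rises /= in novalE.
have orE (P Q Q' : Prop) : (Q <-> Q') -> (P \/ Q) <-> (P \/ Q') by tauto.
split=> [[/(orE _ _ _ (diag_rises_falls _)) di]|[hi noi hne h2]].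
  move=> /(orE _ _ _ (diag_rises_falls _)) di2 /novalE.
  have i2N : i.+2 <= N by case: di2 => [->|[/andP[_ /ltnW]]].
  rewrite i2N negbK => vi1.
  have hi1 := h_gt i2N.
  have hi : h i = i.+1.
    have [k kN hk] := is_valueP _ vi1.
    case: di => [i0|[/andP[i0 _] vi _ vj]].
      by move: hk; have := h_mono (leq0n k); have := h_gt iN; rewrite i0; lia.
    (* The valley on the diagonal makes values and jumps up to [i] equinumerous, so up to [h i]
       there is one value more than up to [i]. That value is [i.+1]; a larger [h i] would be a
       second one. *)
    have := values_le_jumps iN; rewrite -vj => vh.
    have := values_leS i; rewrite vi1 addn1 -vh => vE.
    have := h_gt iN; rewrite leq_eqVlt => /orP[/eqP //|hlt].
    have := values_leS (h i).-1; rewrite prednK ?(leq_ltn_trans _ (h_gt iN)) //.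
    rewrite (_ : is_value (h i)); last by apply/is_valueP; exists i.
    suff : values_le i.+1 <= values_le (h i).-1 by lia.
    rewrite /values_le (_ : (h i).-1 = i.+1 + ((h i).-1 - i.+1)); last by lia.
    by rewrite iotaD count_cat leq_addr.
  split=> //; last 1 first.
  - by case: di2 => [iE|[_ _ -> //]]; rewrite iE h_last (_ : i.+1 = N.-1) //; lia.
  - move=> k kN hk; case: di => [i0|[_ /is_valueP noi _ _]].
      by have := h_gt kN; lia.
    by apply: noi; exists k.
  by rewrite hi; lia.
have i1N : i.+1 < N.
  rewrite ltn_neqAle iN andbT; apply/eqP => iE; case: hne.
  by rewrite iE h_last; lia.
have hi1 : i.+1 < h i.+1 by apply: h_gt.
have nov : ~~ is_value i by apply/is_valueP => -[k kN]; apply: noi.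
have vi1 : is_value i.+1 by apply/is_valueP; exists i.
have vj := values_le_jumps iN; rewrite hi values_leS vi1 addn1 in vj.
case: vj => vj.
split; last by apply/novalE; rewrite vi1 andbF.
- apply/(orE _ _ _ (diag_rises_falls _)).
  have [->|i0] := eqVneq i 0; [by left|right]; split=> //; first by lia.
  have := @h_mono i.-1 i (leq_pred i); have := @h_gt i.-1.
  by have := @noi i.-1; lia.
apply/(orE _ _ _ (diag_rises_falls _)).
have [->|i2N] := eqVneq i.+2 N; [by left|right].
have i2N' : i.+2 < N by lia.
have hi2 := h_gt i2N'.
have nov2 : ~~ is_value i.+2.
  apply/is_valueP => -[k kN hk].
  have [ki|ik] := leqP k i; first by have := h_mono ki; lia.
  by have := h_mono ik; lia.
split=> //.
(* From [i] to [i.+2] there is one new value, [i.+1], and one new jump, at [i.+1], so the equality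
   of counts at [i] persists. *)
rewrite !values_leS !jumps_leS (negbTE nov2) vi1 h2 eqxx.
by move/eqP: hne => ->; rewrite vj /=.
Qed.

End Paths.

End Counting.

(** * Modules and projective resolutions *)

Import GRing.Theory.
Local Open Scope ring_scope.

Lemma linfunE (F : fieldType) (V W : vectType F) (f : V -> W) :
  linear f -> linfun f =1 f.
Proof.
move=> lf v; pose L := GRing.isLinear.Build F V W *:%R f lf.
by pose g : {linear V -> W} := HB.pack f L; apply: (lfunE g).
Qed.

Lemma dimv_add_line (F : fieldType) (V : vectType F) (U : {vspace V}) v :
  v \notin U -> \dim (U + <[v]>) = (\dim U).+1.
Proof.
move=> vU; rewrite dimv_disjoint_sum; last first.
  apply/eqP; rewrite -subv0; apply/subvP => w; rewrite memv_cap => /andP[wU].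
  case/vlineP => k def_w; rewrite {}def_w in wU *.
  have [->|k0] := eqVneq k 0; first by rewrite scale0r mem0v.
  by move: wU; rewrite rpredZeq (negbTE k0) (negbTE vU).
by rewrite dim_vline; case: eqP vU => [->|_ _]; rewrite ?mem0v ?addn1.
Qed.

(** The conditions are boolean and the types are choice types, so [xchoose] makes the choices
    without an axiom. The relation [r] between consecutive terms serves for chain maps and
    homotopies. *)
Lemma dependent_choice (T : nat -> choiceType) (ok : forall k, pred (T k))
    (r : forall k, T k -> T k.+1 -> bool) (x0 : T 0%N) :
    ok 0%N x0 ->
    (forall k x, ok k x -> exists y, ok k.+1 y && r k x y) ->
  exists2 s : forall k, T k, s 0%N = x0 &
    forall k, ok k (s k) /\ r k (s k) (s k.+1).
Proof.
move=> ok0 step.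
pose next k (x : {x | ok k x}) : {y | ok k.+1 y} :=
  let ex := step k (sval x) (svalP x) in
  exist _ (xchoose ex) (andP (xchooseP ex)).1.
pose s := fix s k : {x | ok k x} :=
  match k return {x | ok k x} with
  | 0 => exist _ x0 ok0 | j.+1 => next j (s j) end.
exists (fun k => sval (s k)) => // k; split; first exact: (svalP (s k)).
exact: (andP (xchooseP (step k _ (svalP (s k))))).2.
Qed.

Section Modules.

Variables (F : fieldType) (A : falgType F).
Implicit Types (M X Y P : rmodule A) (e a : A).

Lemma rm_act0l M a : rm_act (0 : M) a = 0.
Proof. by rewrite -ractE linear0. Qed.

Lemma rm_act0r M (m : M) : rm_act m 0 = 0.
Proof.
by have := rm_act_linearr m (-1) 0 0; rewrite !scaleN1r !addNr.
Qed.

Lemma rm_actZr M (m : M) k a : rm_act m (k *: a) = k *: rm_act m a.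
Proof. by have := rm_act_linearr m k a 0; rewrite rm_act0r !addr0. Qed.

Lemma homA_comp M X Y (f : 'Hom(X, Y)) (g : 'Hom(M, X)) :
  f \in homA X Y -> g \in homA M X -> (f \o g)%VF \in homA M Y.
Proof.
move=> /homAP fP /homAP gP; apply/homAP => v a.
by rewrite !comp_lfunE gP fP.
Qed.

Section Submodule.

Variables (M : rmodule A) (U : {vspace M}).
Hypothesis stable : forall u a, u \in U -> rm_act u a \in U.

Let act (v : subvs_of U) a : subvs_of U := vsproj U (rm_act (vsval v) a).

Let actE v a : vsval (act v a) = rm_act (vsval v) a.
Proof. by rewrite vsprojK // stable // subvsP. Qed.

Let act_linearl a : linear (fun v => act v a).
Proof.
by move=> k u v; apply: val_inj; rewrite !linearP /= !actE rm_act_linearl.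
Qed.

Let act_linearr v : linear (act v).
Proof.
by move=> k a b; apply: val_inj; rewrite !linearP /= !actE rm_act_linearr.
Qed.

Let act1 v : act v 1 = v.
Proof. by apply: val_inj; rewrite /= actE rm_act1. Qed.

Let actM v a b : act v (a * b) = act (act v a) b.
Proof. by apply: val_inj; rewrite /= !actE rm_actM. Qed.

Definition sub_rmodule : rmodule A := RModule act_linearl act_linearr act1 actM.

Lemma sub_rm_actE (v : sub_rmodule) a :
  vsval (rm_act v a : subvs_of U) = rm_act (vsval (v : subvs_of U)) a.
Proof. exact: actE. Qed.

End Submodule.

(** The definition of [projective] lifts along surjections; both maps are therefore corestricted to
    the submodule [limg g]. *)
Lemma projective_lift P X Y (g : 'Hom(Y, X)) (f : 'Hom(P, X)) :
    projective P -> g \in homA Y X -> f \in homA P X ->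
    (limg f <= limg g)%VS ->
  exists2 h : 'Hom(P, Y), h \in homA P Y & (g \o h)%VF = f.
Proof.
move=> projP gA fA sfg.
have stab u a : u \in limg g -> rm_act u a \in limg g.
  case/memv_imgP => y _ ->; move/homAP: (gA) => <-.
  by rewrite memv_img ?memvf.
pose W := sub_rmodule stab.
have cores (Z : rmodule A) (k : 'Hom(Z, X)) :
    k \in homA Z X -> (limg k <= limg g)%VS ->
    exists2 k' : 'Hom(Z, W), k' \in homA Z W &
      forall z, vsval (k' z : subvs_of (limg g)) = k z.
  move=> /homAP kA skg.
  have kz z : k z \in limg g by rewrite (subvP skg) ?memv_img ?memvf.
  pose k' : 'Hom(Z, W) := (linfun (vsproj (limg g)) \o k)%VF.
  have k'E z : vsval (k' z : subvs_of (limg g)) = k z.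
    by rewrite comp_lfunE lfunE /= vsprojK.
  exists k' => //; apply/homAP => z a; apply: val_inj.
  apply: etrans (k'E _) _; apply: etrans _ (esym (@sub_rm_actE _ _ stab (k' z) a)).
  by rewrite k'E kA.
have [g' g'A g'E] := cores _ _ gA (subvv _).
have [f' f'A f'E] := cores _ _ fA sfg.
have g'surj : limg g' = fullv.
  apply/eqP; rewrite eqEsubv subvf; apply/subvP => w _.
  have /memv_imgP[y _ wy] := subvsP (w : subvs_of _).
  by apply/memv_imgP; exists y; rewrite ?memvf //; apply: val_inj; rewrite /= g'E.
have [h hA gh] := projP _ _ g' f' g'A g'surj f'A.
exists h => //; apply/lfunP => z; rewrite comp_lfunE -g'E -f'E -gh.
by rewrite comp_lfunE.
Qed.

Definition rideal e : {vspace A} := limg (amull e).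

Lemma ridealP e x : reflect (exists y, x = e * y) (x \in rideal e).
Proof.
apply: (iffP memv_imgP) => [[y _ ->]|[y ->]]; exists y => //.
  by rewrite lfunE.
- by rewrite memvf.
by rewrite lfunE.
Qed.

Lemma mem_rideal e y : e * y \in rideal e.
Proof. by apply/ridealP; exists y. Qed.

Lemma rideal_id e : e \in rideal e.
Proof. by rewrite -[X in X \in _]mulr1 mem_rideal. Qed.

Fact rideal_stable e (x : regular_rmodule A) a :
  x \in rideal e -> rm_act x a \in rideal e.
Proof. by case/ridealP => y ->; rewrite /= -mulrA mem_rideal. Qed.

Definition prmod e : rmodule A := sub_rmodule (@rideal_stable e).

Definition pval e (x : prmod e) : A := vsval (x : subvs_of (rideal e)).
Definition pelt e (x : A) : prmod e := vsproj (rideal e) x.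

Lemma pvalK e : cancel (@pval e) (@pelt e).
Proof. exact: vsvalK. Qed.

Lemma peltK e x : x \in rideal e -> pval (pelt e x) = x.
Proof. exact: vsprojK. Qed.

Lemma pvalP e (x : prmod e) : pval x \in rideal e.
Proof. exact: subvsP. Qed.

Lemma pval_inj e : injective (@pval e).
Proof. exact: can_inj (@pvalK e). Qed.

Lemma pval_linear e : linear (@pval e).
Proof. by move=> k x y; rewrite /pval -linearP. Qed.

Lemma pval_act e (x : prmod e) a : pval (rm_act x a) = pval x * a.
Proof. exact: (sub_rm_actE x a). Qed.

Lemma pval0 e : pval (0 : prmod e) = 0.
Proof. exact: linear0. Qed.

(** For an idempotent [e] these are all the homomorphisms from [e A] to [M], and [m] matters only
    through [m e]; this identifies Hom(eA, M) with M e. *)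
Definition acthom e M (m : M) : 'Hom(prmod e, M) :=
  linfun (fun x => rm_act m (pval x)).

Lemma acthomE e M (m : M) x : acthom e m x = rm_act m (pval x).
Proof.
by rewrite linfunE // => k y z; rewrite pval_linear rm_act_linearr.
Qed.

Lemma acthom_hom e M (m : M) : acthom e m \in homA (prmod e) M.
Proof. by apply/homAP => x a; rewrite !acthomE pval_act rm_actM. Qed.

Section Idempotent.

Variables (e : A) (ee : e * e = e).

Lemma rideal_idem x : x \in rideal e -> e * x = x.
Proof. by case/ridealP => y ->; rewrite mulrA ee. Qed.

Definition pgen : prmod e := pelt e e.

Lemma pval_gen : pval pgen = e.
Proof. by rewrite peltK // rideal_id. Qed.

Lemma hom_acthom M (f : 'Hom(prmod e, M)) :
  f \in homA (prmod e) M -> f = acthom e (f pgen).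
Proof.
move/homAP => fA; apply/lfunP => x; rewrite acthomE -fA; congr (f _).
by apply: pval_inj; rewrite pval_act pval_gen rideal_idem // pvalP.
Qed.

Lemma hom_gen M (f : 'Hom(prmod e, M)) :
  f \in homA (prmod e) M -> rm_act (f pgen) e = f pgen.
Proof.
move/homAP => fA; rewrite -fA; congr (f _).
by apply: pval_inj; rewrite pval_act pval_gen.
Qed.

Lemma projective_prmod : projective (prmod e).
Proof.
move=> M X g f /homAP gA gsurj fA.
have /memv_imgP[m _ gm] : f pgen \in limg g by rewrite gsurj memvf.
exists (acthom e m); first exact: acthom_hom.
apply/lfunP => x; rewrite comp_lfunE acthomE gA -gm.
by rewrite [in RHS](hom_acthom fA) acthomE.
Qed.

End Idempotent.

End Modules.

(** * Comparison of projective resolutions and independence of Ext *)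

Section Comparison.

Variables (F : fieldType) (A : falgType F) (M : rmodule A).
Implicit Types (R : presolution M) (X : rmodule A).

Lemma limg_sub_lker (U V W : vectType F) (g : 'Hom(V, W)) (f : 'Hom(U, V)) :
  (g \o f)%VF = 0 -> (limg f <= lker g)%VS.
Proof.
move=> gf; apply/subvP => _ /memv_imgP[u _ ->]; rewrite memv_ker.
by move/lfunP/(_ u): gf; rewrite comp_lfunE zero_lfunE => ->.
Qed.

Lemma pr_diff_comp R k : (pr_diff R k \o pr_diff R k.+1)%VF = 0.
Proof.
apply/lfunP => x; rewrite comp_lfunE zero_lfunE; apply/eqP.
by rewrite -memv_ker pr_exact memv_img ?memvf.
Qed.

Lemma pr_aug_comp R : (pr_aug R \o pr_diff R 0)%VF = 0.
Proof.
apply/lfunP => x; rewrite comp_lfunE zero_lfunE; apply/eqP.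
by rewrite -memv_ker pr_exact0 memv_img ?memvf.
Qed.

(** Existence half of the comparison theorem. The invariant [ok] keeps the image of
    [h \o pr_diff R k] inside that of [pr_diff R' k], which the next lift requires. *)
Lemma lift_resolution R R' :
  exists f : forall k, 'Hom(pr_mod R k, pr_mod R' k),
  [/\ forall k, f k \in homA (pr_mod R k) (pr_mod R' k),
      (pr_aug R' \o f 0%N)%VF = pr_aug R
    & forall k, (pr_diff R' k \o f k.+1 = f k \o pr_diff R k)%VF].
Proof.
have [f0 f0A f0E] : exists2 h, h \in homA (pr_mod R 0) (pr_mod R' 0) &
    (pr_aug R' \o h)%VF = pr_aug R.
  apply: projective_lift (pr_aug_hom R') (pr_aug_hom R) _.
    exact: pr_projective.
  by rewrite (pr_aug_surj R') subvf.
pose ok k (h : 'Hom(pr_mod R k, pr_mod R' k)) :=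
  (h \in homA (pr_mod R k) (pr_mod R' k)) &&
  (limg (h \o pr_diff R k) <= limg (pr_diff R' k))%VS.
pose r k (h : 'Hom(pr_mod R k, pr_mod R' k))
         (h' : 'Hom(pr_mod R k.+1, pr_mod R' k.+1)) :=
  (pr_diff R' k \o h' == h \o pr_diff R k)%VF.
have ok0 : ok 0%N f0.
  rewrite /ok f0A -pr_exact0; apply: limg_sub_lker.
  by rewrite comp_lfunA f0E pr_aug_comp.
have step k h : ok k h -> exists h', ok k.+1 h' && r k h h'.
  case/andP => hA sh.
  have [h' h'A h'E] := projective_lift (@pr_projective _ _ _ R k.+1)
    (pr_diff_hom R' k) (homA_comp hA (pr_diff_hom R k)) sh.
  exists h'; rewrite /ok /r h'A h'E eqxx andbT /= -pr_exact.
  apply: limg_sub_lker.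
  by rewrite comp_lfunA h'E -comp_lfunA pr_diff_comp comp_lfun0r.
have [f f0' fP] := dependent_choice ok0 step.
exists f; split=> [k||k]; last by case: (fP k) => _ /eqP.
  by case: (fP k) => /andP[].
by rewrite f0'.
Qed.

(** Uniqueness half of the comparison theorem. The invariant [ok] says that the error left by the
    homotopy so far is a cycle; by exactness it lifts along the next differential. *)
Lemma homotopy_zero R (v : forall k, 'Hom(pr_mod R k, pr_mod R k)) :
    (forall k, v k \in homA (pr_mod R k) (pr_mod R k)) ->
    (pr_aug R \o v 0%N)%VF = 0 ->
    (forall k, (pr_diff R k \o v k.+1 = v k \o pr_diff R k)%VF) ->
  exists s : forall k, 'Hom(pr_mod R k, pr_mod R k.+1),
  [/\ forall k, s k \in homA (pr_mod R k) (pr_mod R k.+1),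
      v 0%N = (pr_diff R 0%N \o s 0%N)%VF
    & forall k, v k.+1 =
        (pr_diff R k.+1 \o s k.+1)%VF + (s k \o pr_diff R k)%VF].
Proof.
move=> vA v0 vE.
have [s0 s0A s0E] : exists2 h, h \in homA (pr_mod R 0) (pr_mod R 1) &
    (pr_diff R 0 \o h)%VF = v 0%N.
  apply: projective_lift (pr_diff_hom R _) (vA 0%N) _.
    exact: pr_projective.
  by rewrite -pr_exact0 limg_sub_lker.
pose ok k (h : 'Hom(pr_mod R k, pr_mod R k.+1)) :=
  (h \in homA (pr_mod R k) (pr_mod R k.+1)) &&
  (pr_diff R k \o (v k.+1 - (h \o pr_diff R k)) == 0)%VF.
pose r k (h : 'Hom(pr_mod R k, pr_mod R k.+1))
         (h' : 'Hom(pr_mod R k.+1, pr_mod R k.+2)) :=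
  (v k.+1 == (pr_diff R k.+1 \o h') + (h \o pr_diff R k))%VF.
have ok0 : ok 0%N s0.
  by rewrite /ok s0A comp_lfunDr comp_lfunNr comp_lfunA s0E vE subrr /=.
have step k h : ok k h -> exists h', ok k.+1 h' && r k h h'.
  case/andP => hA /eqP dh.
  have wA : (v k.+1 - (h \o pr_diff R k))%VF \in
      homA (pr_mod R k.+1) (pr_mod R k.+1).
    by rewrite rpredB ?vA // homA_comp // pr_diff_hom.
  have [|h' h'A h'E] := projective_lift (@pr_projective _ _ _ R k.+1)
    (pr_diff_hom R k.+1) wA; first by rewrite -pr_exact limg_sub_lker.
  exists h'; rewrite /ok /r h'A h'E subrK eqxx andbT /=.
  rewrite comp_lfunDr comp_lfunNr comp_lfunA h'E vE comp_lfunDl comp_lfunNl.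
  by rewrite opprB addrC -comp_lfunA subrK pr_diff_comp comp_lfun0r.
have [s s0' sP] := dependent_choice ok0 step.
exists s; split=> [k||k]; last by case: (sP k) => _ /eqP.
  by case: (sP k) => /andP[].
by rewrite s0'.
Qed.

Lemma cocyclesP R X k (f : 'Hom(pr_mod R k, X)) :
  reflect (f \in homA (pr_mod R k) X /\ (f \o pr_diff R k)%VF = 0)
          (f \in cocycles R X k).
Proof.
rewrite memv_cap memv_ker precompE.
by apply: (iffP andP) => -[fA]; [move/eqP | move=> ->].
Qed.

Lemma coboundariesP R X k (f : 'Hom(pr_mod R k.+1, X)) :
  reflect (exists2 g, g \in homA (pr_mod R k) X & f = (g \o pr_diff R k)%VF)
          (f \in coboundaries R X k.+1).
Proof.
apply: (iffP memv_imgP) => -[g gA fE]; exists g => //.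
  by rewrite fE precompE.
by rewrite fE precompE.
Qed.

Lemma coboundaries_sub R X k : (coboundaries R X k <= cocycles R X k)%VS.
Proof.
case: k => [|k]; first exact: sub0v.
apply/subvP => f /coboundariesP[g gA ->]; apply/cocyclesP.
by rewrite homA_comp ?pr_diff_hom // -comp_lfunA pr_diff_comp comp_lfun0r.
Qed.

(** As [v] is null-homotopic, a cocycle [z] is [fs (z \o g k)] up to a coboundary. So [Z] lies in
    the sum of [fs @: Z'] and [B], while [fs @: B'] lies in [B]. The kernel of [fs] meets [Z'] in at
    least as much as [B'], and counting dimensions gives the inequality. *)
Lemma ext_dim_le R R' X k :
  (\dim (cocycles R X k) - \dim (coboundaries R X k) <=
   \dim (cocycles R' X k) - \dim (coboundaries R' X k))%N.
Proof.
have [f [fA f0 fE]] := lift_resolution R R'.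
have [g [gA g0 gE]] := lift_resolution R' R.
pose v j : 'Hom(pr_mod R j, pr_mod R j) := ((g j \o f j) - \1)%VF.
have idA (P : rmodule A) : (\1%VF : 'End(P)) \in homA P P.
  by apply/homAP => x a; rewrite !id_lfunE.
have [||j|s [sA s0 sE]] := @homotopy_zero R v.
- by move=> j; rewrite rpredB ?homA_comp ?idA.
- rewrite comp_lfunDr comp_lfunNr comp_lfun1r comp_lfunA g0 f0.
  exact: subrr.
- rewrite comp_lfunDr comp_lfunNr comp_lfun1r comp_lfunDl comp_lfunNl.
  by rewrite comp_lfun1l comp_lfunA gE -!comp_lfunA fE.
have null_cob z : z \in cocycles R X k -> (z \o v k)%VF \in coboundaries R X k.
  case/cocyclesP; case: k z => [|j] z zA zd.
    by rewrite s0 comp_lfunA zd comp_lfun0l mem0v.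
  rewrite sE comp_lfunDr comp_lfunA zd comp_lfun0l add0r.
  by apply/coboundariesP; exists (z \o s j)%VF; rewrite ?homA_comp ?comp_lfunA.
set Z := cocycles R X k; set B := coboundaries R X k.
set Z' := cocycles R' X k; set B' := coboundaries R' X k.
pose fs := precomp X (f k).
have fsB : (fs @: B' <= B)%VS.
  rewrite /fs /B /B'; case: (k) => [|j] /=; first by rewrite limg0 sub0v.
  apply/subvP => _ /memv_imgP[_ /coboundariesP[z zA ->] ->].
  rewrite precompE; apply/coboundariesP; exists (z \o f j)%VF.
    by rewrite homA_comp.
  by rewrite -!comp_lfunA fE.
have sZ : (Z <= fs @: Z' + B)%VS.
  apply/subvP => z /cocyclesP[zA zd].
  have -> : z = (fs (z \o g k)%VF - (z \o v k)%VF).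
    rewrite precompE comp_lfunDr comp_lfunNr comp_lfun1r comp_lfunA opprB.
    by rewrite addrCA subrr addr0.
  apply: memv_add.
    apply: memv_img; apply/cocyclesP; split; first by rewrite homA_comp.
    by rewrite -comp_lfunA -gE comp_lfunA zd comp_lfun0l.
  by rewrite memvN; apply: null_cob; apply/cocyclesP.
have sB'Z' : (B' <= Z')%VS by apply: coboundaries_sub.
have := dimvS sZ; have := dimv_sum_cap (fs @: Z')%VS B.
have : (\dim (fs @: B') <= \dim ((fs @: Z') :&: B))%N.
  by apply: dimvS; rewrite subv_cap fsB limgS.
have := limg_ker_dim fs Z'; have := limg_ker_dim fs B'.
have : (\dim (B' :&: lker fs) <= \dim (Z' :&: lker fs))%N.
  by apply: dimvS; rewrite capvS.
have := dimvS sB'Z'.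
move: (\dim B') (\dim Z') (\dim B) (\dim Z) (\dim (B' :&: _)).
move: (\dim (Z' :&: _)) (\dim (fs @: B')) (\dim (fs @: Z')).
move: (\dim (_ + B)) (\dim (_ :&: B)); lia.
Qed.

Lemma ext_dim_eqE R X k d :
  ext_dim_eq M X k d <->
  (\dim (cocycles R X k) - \dim (coboundaries R X k))%N = d.
Proof.
split=> [[R' <-]|Rd]; last by exists R.
by apply/eqP; rewrite eqn_leq !ext_dim_le.
Qed.

(** A resolution that vanishes beyond [j] has no nonzero cocycle in degree [k], and the dimension of
    Ext may be computed with it. *)
Lemma pd_le_ext R X j k : pd_le M j -> (j < k)%N ->
  (cocycles R X k <= coboundaries R X k)%VS.
Proof.
case=> R' R'0 jk.
have : ext_dim_eq M X k 0.
  exists R'; suff -> : cocycles R' X k = 0%VS by rewrite dimv0.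
  apply/eqP; rewrite -subv0; apply/subvP => f _; rewrite memv0.
  apply/eqP/lfunP => x; move/eqP: (R'0 k jk); rewrite dimv_eq0 => /eqP full0.
  have : x \in fullv by rewrite memvf.
  by rewrite full0 memv0 => /eqP->; rewrite !linear0.
move/(ext_dim_eqE R) => /eqP; rewrite subn_eq0 => le_dim.
by rewrite -(geq_leqif (dimv_leqif_sup (coboundaries_sub R X k))).
Qed.

End Comparison.

(** * Nakayama algebras *)

Section PathElements.

Variables (F : fieldType) (N : nat).
Implicit Types (a b c : nat) (f g : pathalg F N).

(* Equals 0 unless a <= b <= N. *)
Definition pathelt a b : pathalg F N :=
  [ffun p => ((psrc p == a :> nat) && (ptgt p == b :> nat))%:R].

Lemma pcoef_pathelt a b (i j : 'I_N.+1) :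
  pcoef (pathelt a b) i j = [&& a <= b, i == a :> nat & j == b :> nat]%N%:R.
Proof.
have [ij|ij] := leqP i j.
  pose p : lpath N := exist _ (i, j) ij.
  rewrite -[LHS]/(pcoef _ (psrc p) (ptgt p)) pcoef_path ffunE /psrc /ptgt /=.
  by case: (eqVneq (i : nat) a) (eqVneq (j : nat) b) => [<-|_] [<-|_];
    rewrite ?ij ?andbF.
rewrite pcoef_out -?ltnNge //.
case: (eqVneq (i : nat) a) (eqVneq (j : nat) b) => [<-|_] [<-|_];
  by rewrite ?andbF // leqNgt ij.
Qed.

Lemma pathelt_out a b : ~~ (a <= b <= N)%N -> pathelt a b = 0.
Proof.
move=> ab; apply/ffunP => p; rewrite !ffunE.
case: eqP => //= pa; case: eqP => //= pb; case/negP: ab.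
by rewrite -pa -pb (valP p) -ltnS ltn_ord.
Qed.

Lemma patheltM a b c d : pathelt a b * pathelt c d =
  if [&& b == c, a <= b & b <= d]%N then pathelt a d else 0.
Proof.
apply: pcoefP => i j; rewrite [LHS]pcoefM.
under eq_bigr => k _ do rewrite !pcoef_pathelt -natrM mulnb.
case: ifP => [/and3P[/eqP <- ab bd]|abcd]; last first.
  rewrite big1 => [|k _]; last first.
    rewrite (_ : _ && _ = false) //; apply/negP.
    case/andP => /and3P[ab _ /eqP kb] /and3P[cd /eqP kc _].
    by rewrite -kb kc eqxx -[X in (a <= X)%N]kc kb ab cd in abcd.
  by rewrite /pcoef; case: insub => // p; rewrite ffunE.
rewrite pcoef_pathelt (leq_trans ab bd) ab bd /=.
have [bN|Nb] := leqP b N; last first.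
  rewrite big1 => [|k _].
    rewrite (_ : (j == d :> nat) = false) ?andbF //.
    by apply/eqP => jd; have := ltn_ord j; lia.
  rewrite (_ : (k == b :> nat) = false) ?andbF //.
  by apply/eqP => kb; have := ltn_ord k; lia.
rewrite (bigD1 (Ordinal (bN : (b < N.+1)%N))) //= eqxx andbT big1 ?addr0 //.
move=> k kb; rewrite (_ : (k == b :> nat) = false) ?andbF //.
by apply: contraNF kb => kb; apply/eqP/val_inj/eqP.
Qed.

Lemma pathelt_sum f : f =
  \sum_(a < N.+1) \sum_(b < N.+1) pcoef f a b *: pathelt a b.
Proof.
apply/ffunP => p; rewrite sum_ffunE (bigD1 (psrc p)) //= sum_ffunE.
rewrite (bigD1 (ptgt p)) //= [X in _ + X + _]big1 => [|b bp]; last first.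
  by rewrite !ffunE eqxx /= eq_sym val_eqE (negbTE bp) scaler0.
rewrite [X in _ + X]big1 => [|a ap]; last first.
  rewrite sum_ffunE big1 // => b _.
  by rewrite !ffunE val_eqE eq_sym (negbTE ap) scaler0.
by rewrite !addr0 !ffunE !eqxx pcoef_path; apply: esym; apply: mulr1.
Qed.

(* Its kernel, spanned by the paths of length at least l, contains J^l. *)
Definition trunc l f : pathalg F N :=
  [ffun p => if (plength p < l)%N then f p else 0].

Fact trunc_linear l : linear (trunc l).
Proof.
by move=> k f g; apply/ffunP => p; rewrite !ffunE; case: ifP => //;
  rewrite scaler0 addr0.
Qed.

Lemma truncP l f : reflect
  (forall i j : 'I_N.+1, (j < i + l)%N -> pcoef f i j = 0)
  (f \in lker (linfun (trunc l))).
Proof.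
rewrite memv_ker linfunE; last exact: trunc_linear.
apply: (iffP eqP) => [/ffunP f0 i j ijl|f0].
  have [ij|ij] := boolP (i <= j)%N; last by rewrite pcoef_out.
  pose p : lpath N := exist _ (i, j) ij.
  rewrite -[LHS]/(pcoef _ (psrc p) (ptgt p)) pcoef_path.
  by have := f0 p; rewrite !ffunE /plength /psrc /ptgt /= ltn_subLR // ijl.
apply/ffunP => p; rewrite !ffunE; case: ifP => // pl; rewrite -pcoef_path.
by rewrite f0 //; move: pl; rewrite /plength ltn_subLR // (valP p).
Qed.

Lemma trunc_prod l m f g :
    f \in lker (linfun (trunc l)) -> g \in lker (linfun (trunc m)) ->
  f * g \in lker (linfun (trunc (l + m))).
Proof.
move=> /truncP f0 /truncP g0; apply/truncP => i j ij.
rewrite [LHS]pcoefM big1 // => k _.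
have [kl|kl] := ltnP k (i + l); first by rewrite f0 ?mul0r.
by rewrite g0 ?mulr0 //; lia.
Qed.

Lemma trunc0 f : f \in lker (linfun (trunc 0)).
Proof. by apply/truncP => i j ij; rewrite pcoef_out // -ltnNge; lia. Qed.

Lemma arrow_ideal_trunc : (arrow_ideal F N <= lker (linfun (trunc 1)))%VS.
Proof.
apply/prodvP => f g + _ => fJ; rewrite -[1%N]addn0; apply: trunc_prod (trunc0 g).
move: f fJ; apply/subvP/prodvP => f {}g _ gJ.
rewrite -[1%N]add0n; apply: trunc_prod (trunc0 f) _.
move: g gJ; apply/subvP/span_subvP => _ /mapP[p + ->].
rewrite mem_enum inE => /eqP p1; apply/truncP => i j ij.
have [le_ij|le_ij] := boolP (i <= j)%N; last by rewrite pcoef_out.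
pose q : lpath N := exist _ (i, j) le_ij.
rewrite -[LHS]/(pcoef _ (psrc q) (ptgt q)) pcoef_path ffunE.
case: eqP => // qp; move: p1; rewrite -qp /plength /psrc /ptgt /= => ?.
lia.
Qed.

Lemma arrow_ideal2_trunc : (arrow_ideal F N ^+ 2 <= lker (linfun (trunc 2)))%VS.
Proof.
apply/prodvP => f g fJ gJ; apply: (@trunc_prod 1 1).
  exact: subvP arrow_ideal_trunc _ fJ.
exact: subvP arrow_ideal_trunc _ gJ.
Qed.

End PathElements.

(** * Images of paths in a Nakayama algebra and its Kupisch series *)

Section Nakayama.

Variables (F : fieldType) (N : nat) (A : lnakayama F N).
Implicit Types (a b c j : nat) (x y : A).

Definition upath a b : A := lnak_proj A (pathelt F N a b).

Local Notation u := upath.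

Lemma upath_out a b : ~~ (a <= b <= N)%N -> u a b = 0.
Proof. by move=> ab; rewrite /u pathelt_out ?linear0. Qed.

Lemma upathM a b c d :
  u a b * u c d = if [&& b == c, a <= b & b <= d]%N then u a d else 0.
Proof. by rewrite -rmorphM patheltM; case: ifP => //; rewrite rmorph0. Qed.

Lemma upath_cat a b c : (a <= b <= c)%N -> u a b * u b c = u a c.
Proof. by move=> abc; rewrite upathM eqxx abc. Qed.

Lemma upath_idl a b : u a a * u a b = u a b.
Proof.
rewrite upathM eqxx leqnn /=; case: leqP => // ba.
by rewrite upath_out // leqNgt ba.
Qed.

Lemma upath_idr a b : u a b * u b b = u a b.
Proof.
rewrite upathM eqxx leqnn /= andbT; case: leqP => // ba.
by rewrite upath_out // leqNgt ba.
Qed.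

Lemma upath_idl0 a b c : a != b -> u a a * u b c = 0.
Proof. by move=> ab; rewrite upathM (negbTE ab). Qed.

Lemma upath_idr0 a b c : b != c -> u a b * u c c = 0.
Proof. by move=> bc; rewrite upathM (negbTE bc). Qed.

Lemma idem_upath (i : 'I_N.+1) : idem A i = u i i.
Proof.
congr (lnak_proj A _); by apply/ffunP => p; rewrite !ffunE.
Qed.

Lemma upath_ex x : exists k : nat -> nat -> F,
  x = \sum_(a < N.+1) \sum_(b < N.+1) k a b *: u a b.
Proof.
have /memv_imgP[f _ ->] : x \in limg (lnak_proj A).
  by rewrite lnak_surj memvf.
exists (fun a b => pcoef f (inord a) (inord b)).
rewrite {1}[f]pathelt_sum linear_sum; apply: eq_bigr => a _.
rewrite linear_sum; apply: eq_bigr => b _.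
by rewrite linearZ /= !inord_val.
Qed.

Lemma one_sum_upath : 1 = \sum_(a < N.+1) u a a.
Proof.
rewrite -(rmorph1 (lnak_proj A)) -linear_sum; congr (lnak_proj A _).
apply/ffunP => p; rewrite sum_ffunE (bigD1 (psrc p)) //= big1 => [|a ap].
  by rewrite !ffunE eqxx addr0 eq_sym.
by rewrite !ffunE val_eqE eq_sym (negbTE ap).
Qed.

(** The linear quiver has at most one path from [a] to [b], so each Peirce component is at most
    one-dimensional. *)
Lemma upath_corner a b x : exists k : F, u a a * x * u b b = k *: u a b.
Proof.
have [/andP[ab bN]|abN] := boolP (a <= b <= N)%N; last first.
  exists 0; rewrite scale0r; have [k ->] := upath_ex x.
  rewrite mulr_sumr mulr_suml big1 // => c _.
  rewrite mulr_sumr mulr_suml big1 // => d _.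
  rewrite -scalerAr -scalerAl.
  have [<-|ac] := eqVneq a c; last by rewrite upath_idl0 // mul0r scaler0.
  rewrite upath_idl; have [->|bd] := eqVneq (d : nat) b.
    by rewrite upath_idr upath_out ?scaler0.
  by rewrite upath_idr0 ?scaler0.
have [k ->] := upath_ex x; exists (k a b).
have aN : (a < N.+1)%N by apply: leq_ltn_trans ab _.
have bN' : (b < N.+1)%N by [].
rewrite mulr_sumr mulr_suml (bigD1 (Ordinal aN)) //= [X in _ + X]big1.
  rewrite addr0 mulr_sumr mulr_suml (bigD1 (Ordinal bN')) //= big1.
    by rewrite addr0 -scalerAr -scalerAl upath_idl upath_idr.
  by move=> d db; rewrite -scalerAr -scalerAl upath_idl upath_idr0 ?scaler0.
move=> c ca; rewrite mulr_sumr mulr_suml big1 // => d _.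
by rewrite -scalerAr -scalerAl upath_idl0 ?mul0r ?scaler0 // eq_sym.
Qed.

(** The relations lie in the square of the arrow ideal, whereas vertices and arrows have length less
    than two. *)
Lemma upath_neq0 a b : (a <= b <= N)%N -> (b <= a.+1)%N -> u a b != 0.
Proof.
move=> /andP[ab bN] ba; rewrite /upath -memv_ker; apply/negP => abK.
have [m _ [_ K2]] := lnak_admissible A.
have := subvP (arrow_ideal2_trunc F N) _ (subvP K2 _ abK).
move/truncP/(_ (inord a) (inord b)); rewrite pcoef_pathelt !inordK; [|lia..].
rewrite ab !eqxx addn2 /= => /(_ ba)/eqP; exact/negP/oner_neq0.
Qed.

Lemma upath_neq0_sub a b c d :
  (a <= b)%N -> (b <= c)%N -> (c <= d)%N -> u a d != 0 -> u b c != 0.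
Proof.
move=> ab bc cd; apply: contra => /eqP bc0.
rewrite -(@upath_cat a b d) ?ab ?(leq_trans bc) //.
by rewrite -(@upath_cat b c d) ?bc // bc0 mul0r mulr0.
Qed.

(* One more than the last vertex b with e_a A e_b <> 0; equals a if a > N. *)
Definition bound a : nat := (a + count (fun b => u a b != 0%R) (iota 0 N.+1))%N.

Local Notation g := bound.

Lemma bound_ge a : (a <= g a)%N.
Proof. exact: leq_addr. Qed.

(** Initial segments of a nonzero path are nonzero, so the targets of the nonzero paths from [a]
    form an interval starting at [a]; [bound] adds its length to [a]. *)
Lemma upath_boundE a b : (u a b != 0) = (a <= b < g a)%N.
Proof.
have ab0 c : ~~ (a <= c <= N)%N -> u a c != 0 = false.
  by move=> ac; rewrite upath_out ?eqxx.
have [aN|Na] := leqP a N; last first.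
  rewrite /g (eq_in_count (a2 := pred0)) ?count_pred0 => [|c _]; last first.
    by rewrite ab0 //; lia.
  by rewrite ab0; lia.
have ex0 : exists c, ~~ ((a <= c)%N ==> (u a c != 0)).
  by exists N.+1; rewrite negb_imply ab0; lia.
(* Here [m] is the first vertex from [a] on that no nonzero path from [a] reaches; it is [N.+1] at
   the latest. *)
case: (ex_minnP ex0) => m; rewrite negb_imply => /andP[am um] minm.
have uE c : (u a c != 0) = (a <= c < m)%N.
  have [ac|ca] := leqP a c; last by rewrite ab0 //; lia.
  apply/idP/idP => /= [uc|cm].
    by rewrite ltnNge; apply: contra um => mc; apply: upath_neq0_sub uc.
  by apply: contraTT cm => uc; rewrite -leqNgt minm // ac.
have mN : (m <= N.+1)%N by apply: minm; rewrite negb_imply ab0; lia.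
rewrite uE /g; congr (_ && (_ < _)%N).
rewrite (eq_count uE) -size_filter.
have -> : [seq c <- iota 0 N.+1 | (a <= c < m)%N] = iota a (m - a).
  apply: (irr_sorted_eq ltn_trans ltnn).
  - by apply: sorted_filter (iota_ltn_sorted _ _); apply: ltn_trans.
  - exact: iota_ltn_sorted.
  move=> c; rewrite mem_filter !mem_iota; lia.
by rewrite size_iota; lia.
Qed.

Lemma bound_le a : (a <= N.+1)%N -> (g a <= N.+1)%N.
Proof.
move=> aN; have [//|Ng] := leqP (g a) N.+1.
suff : u a N.+1 != 0 by rewrite upath_out ?eqxx // ltnn andbF.
by rewrite upath_boundE aN.
Qed.

Lemma bound_max : g N.+1 = N.+1.
Proof. by apply/eqP; rewrite eqn_leq bound_le ?bound_ge. Qed.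

Lemma bound_mono a b : (a <= b)%N -> (g a <= g b)%N.
Proof.
move=> ab; have [ga|bg] := leqP (g a) b; first exact: leq_trans (bound_ge b).
have : u a (g a).-1 != 0 by rewrite upath_boundE; lia.
move/(@upath_neq0_sub a b (g a).-1)=> /(_ ab).
by rewrite upath_boundE; lia.
Qed.

Lemma bound_ge2 a : (a < N)%N -> (a.+2 <= g a)%N.
Proof.
move=> aN; have : u a a.+1 != 0 by apply: upath_neq0; lia.
by rewrite upath_boundE => /andP[].
Qed.

Lemma bound_last : g N = N.+1.
Proof.
have : u N N != 0 by apply: upath_neq0; lia.
by rewrite upath_boundE; have := @bound_le N; lia.
Qed.

Lemma mul_upath_sum x : x = \sum_(b < N.+1) x * u b b.
Proof. by rewrite -mulr_sumr -one_sum_upath mulr1. Qed.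

Lemma mem_upath_comp (U : {vspace A}) x :
  (forall b, (b <= N)%N -> x * u b b \in U) -> x \in U.
Proof.
move=> xU; rewrite [x]mul_upath_sum memv_suml // => b _.
by rewrite xU // -ltnS.
Qed.

(** The nonzero paths from [i] form a basis of [e_i A]; multiplying a linear relation on the right
    by a vertex idempotent isolates one coefficient. *)
Lemma kupischE (i : 'I_N.+1) : (kupisch A i + i = g i)%N.
Proof.
set c := (g i - i)%N.
suff -> : kupisch A i = c by rewrite subnK // bound_ge.
pose e : c.-tuple A := [tuple u i (i + k)%N | k < c].
have spanE : (<[idem A i]> * {:A})%VS = <<e>>%VS.
  apply/eqP; rewrite eqEsubv; apply/andP; split.
    apply/prodvP => _ y /vlineP[k ->] _; rewrite -scalerAl memvZ //.
    apply: mem_upath_comp => b bN; rewrite idem_upath.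
    have [k' ->] := upath_corner i b y; rewrite memvZ //.
    have [->|] := eqVneq (u i b) 0; first exact: mem0v.
    rewrite upath_boundE => /andP[ib bg]; apply: memv_span.
    have bc : (b - i < c)%N by rewrite /c; lia.
    apply/mapP; exists (Ordinal bc); first by rewrite mem_enum.
    by rewrite /= subnKC.
  apply/span_subvP => _ /mapP[k _ ->]; rewrite -upath_idl -idem_upath.
  by rewrite memv_mul ?memv_line ?memvf.
rewrite /kupisch spanE; suff /eqP -> : free e by rewrite size_tuple.
apply/freeP => k k0 j; have uj : u i (i + j) != 0.
  by rewrite upath_boundE; have := ltn_ord j; rewrite /c; lia.
have eE (l : 'I_c) : e`_l = u i (i + l)%N by rewrite -tnth_nth tnth_mktuple.
have : (\sum_(l < c) k l *: e`_l) * u (i + j) (i + j) = 0.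
  by rewrite k0 mul0r.
under eq_bigr do rewrite eE; rewrite mulr_suml (bigD1 j) //= big1 => [|l lj].
  rewrite addr0 -scalerAl upath_idr => /eqP.
  by rewrite scaler_eq0 (negbTE uj) orbF => /eqP.
by rewrite -scalerAl upath_idr0 ?scaler0 // eqn_add2l.
Qed.

End Nakayama.

Lemma acthom_eq0 (F : fieldType) (A : falgType F) (e : A) (M : rmodule A)
    (m : M) : e * e = e -> (acthom e m == 0) = (rm_act m e == 0).
Proof.
move=> ee; apply/eqP/eqP => [m0|m0].
  by rewrite -[in LHS](pval_gen e) -acthomE m0 zero_lfunE.
apply/lfunP => x; rewrite zero_lfunE acthomE.
by rewrite -(rideal_idem ee (pvalP x)) rm_actM m0 rm_act0l.
Qed.

(** * Projective modules at the vertices and the maps between them *)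

Section NakayamaModules.

Variables (F : fieldType) (N : nat) (A : lnakayama F N).
Implicit Types (a b c j : nat) (x y : A) (M : rmodule A).

Local Notation u := (upath A).
Local Notation g := (bound A).
Local Notation regA := (regular_rmodule A).

(** The vertex ranges over [nat], so that [proj_at N.+1] is the zero module and can end a
    resolution. *)
Definition proj_at a : rmodule A := prmod (u a a).

Definition pdiff a b : 'Hom(proj_at b, proj_at a) :=
  acthom (u b b) (pelt (u a a) (u a b)).

Lemma pdiffE a b (x : proj_at b) : pval (pdiff a b x) = u a b * pval x.
Proof.
rewrite /pdiff acthomE pval_act peltK //.
by apply/ridealP; exists (u a b); rewrite upath_idl.
Qed.

Lemma acthom_pdiff M (m : M) a b :
  (acthom (u a a) m \o pdiff a b)%VF = acthom (u b b) (rm_act m (u a b)).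
Proof.
apply/lfunP => x.
by rewrite comp_lfunE [LHS]acthomE pdiffE rm_actM [RHS]acthomE.
Qed.

Lemma projective_proj_at a : projective (proj_at a).
Proof. by apply: projective_prmod; rewrite upath_idl. Qed.

Lemma homA_proj_at b M (f : 'Hom(proj_at b, M)) : f \in homA (proj_at b) M ->
  exists2 m : M, rm_act m (u b b) = m & f = acthom (u b b) m.
Proof.
move=> fA; have bb := upath_idl A b b; exists (f (pgen (u b b))).
  exact (hom_gen bb fA).
exact (hom_acthom bb fA).
Qed.

Lemma dim_proj_at_out : \dim {:proj_at N.+1} = 0%N.
Proof.
apply/eqP; rewrite dimv_eq0 -subv0; apply/subvP => x _; rewrite memv0.
apply/eqP/pval_inj; have /ridealP[y ->] := pvalP x.
by rewrite pval0 upath_out ?mul0r // ltnn andbF.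
Qed.

Lemma upath_left0 a b y : (b < a)%N -> u a a * y * u b b = 0.
Proof.
move=> ba; have [k ->] := upath_corner a b y.
by rewrite upath_out ?scaler0 // leqNgt ba.
Qed.

Lemma mul_upath_suml x : x = \sum_(a < N.+1) u a a * x.
Proof. by rewrite -mulr_suml -one_sum_upath mul1r. Qed.

(** The kernel is spanned by the paths from [b] to [j] with [maxn b (g a) <= j < g b], the image by
    those with [c <= j < g b]. The equation of minima says that the two intervals coincide, possibly
    both being empty. *)
Lemma pdiff_exact a b c : (a <= b <= c)%N ->
  minn (g b) (maxn b (g a)) = minn (g b) c ->
  lker (pdiff a b) = limg (pdiff b c).
Proof.
case/andP=> ab bc gE; have gab := bound_mono A ab; have gbc := bound_mono A bc.
apply/eqP; rewrite eqEsubv; apply/andP; split; apply/subvP => x; last first.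
  case/memv_imgP => y _ ->; rewrite memv_ker; apply/eqP/pval_inj.
  rewrite !pdiffE mulrA upath_cat ?ab // pval0.
  have [->|] := eqVneq (u a c) 0; first by rewrite mul0r.
  by rewrite upath_boundE; lia.
rewrite memv_ker => /eqP/(congr1 (@pval _ _ _)); rewrite pdiffE pval0 => x0.
suff /ridealP[y xy] : pval x \in rideal (u b c).
  apply/memv_imgP; exists (pelt (u c c) (u c c * y)); first exact: memvf.
  apply: pval_inj; rewrite pdiffE peltK ?mem_rideal //.
  by rewrite mulrA upath_idr.
apply: mem_upath_comp => j jN.
have [k] := upath_corner b j (pval x).
rewrite (rideal_idem (upath_idl A b b) (pvalP x)) => xE.
have [k0|k0] := eqVneq k 0; first by rewrite xE k0 scale0r mem0v.
have [u0|] := eqVneq (u b j) 0; first by rewrite xE u0 scaler0 mem0v.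
rewrite upath_boundE => /andP[bj jg].
have /eqP : u a b * (pval x * u j j) = 0 by rewrite mulrA x0 mul0r.
rewrite xE -scalerAr upath_cat ?ab // scaler_eq0 (negbTE k0) /= => uaj.
have gaj : (g a <= j)%N.
  by have := upath_boundE A a j; rewrite uaj; lia.
have cj : (c <= j)%N by lia.
by rewrite -(@upath_cat _ _ A b c j) ?bc // scalerAr mem_rideal.
Qed.

Lemma arrow_decomp b y : (b < N)%N -> y * u b.+1 b.+1 = y ->
  exists k y', y = k *: u b.+1 b.+1 + y' * u b b.+1.
Proof.
move=> bN yb; rewrite [y]mul_upath_suml.
elim/big_ind: _ => [|_ _ [k [y' ->]] [k' [y'' ->]]|c _].
- by exists 0, 0; rewrite scale0r mul0r addr0.
- by exists (k + k'), (y' + y''); rewrite scalerDl mulrDl addrACA.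
have [k yE] := upath_corner c b.+1 y; rewrite -yb mulrA yE.
have [cb|bc|->] := ltngtP c b.+1.
- exists 0, (k *: u c b); rewrite scale0r add0r -scalerAl upath_cat //.
  by rewrite -ltnS cb leqnSn.
- exists 0, 0; rewrite upath_out ?scaler0 ?scale0r ?mul0r ?addr0 //.
  by rewrite leqNgt bc.
by exists k, 0; rewrite mul0r addr0.
Qed.

(** * Resolutions of a simple module along a sequence of vertices *)

Section Resolution.

Variables (i : nat) (S : rmodule A) (v : S).
Hypotheses (iN : (i < N)%N) (simpleS : simple_rmodule S).
Hypotheses (vi : rm_act v (u i i) = v) (v0 : v != 0).

Lemma simple_generated (w : S) :
  w != 0 -> forall z : S, exists x, z = rm_act w x.
Proof.
move=> w0 z; case: simpleS => _ /(_ (limg (linfun (@rm_act _ A S w)))).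
have wE x : linfun (@rm_act _ A S w) x = rm_act w x.
  by rewrite linfunE //; apply: rm_act_linearr.
case=> [t x /memv_imgP[y _ ->]|W0|WT].
- by rewrite wE -rm_actM -wE memv_img ?memvf.
- have : linfun (@rm_act _ A S w) 1 \in limg (linfun (@rm_act _ A S w)).
    by rewrite memv_img ?memvf.
  by rewrite W0 memv0 wE rm_act1 (negbTE w0).
have : z \in limg (linfun (@rm_act _ A S w)) by rewrite WT memvf.
by case/memv_imgP => x _ ->; exists x.
Qed.

(** A nonzero image of [v] under the path would generate [v], but no path leads back from [j] to
    [i]. *)
Lemma simple_act_path j : (i < j)%N -> rm_act v (u i j) = 0.
Proof.
move=> ij; apply/eqP/negP => /negP w0.
have [x vx] := simple_generated w0 v; case/negP: v0; apply/eqP.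
rewrite -vi vx -!rm_actM -(upath_idr A i j) -!mulrA.
by rewrite [X in _ * X]mulrA upath_left0 // mulr0 rm_act0r.
Qed.

Definition augm : 'Hom(proj_at i, S) := acthom (u i i) v.

Lemma augm_surj : limg augm = fullv.
Proof.
apply/eqP; rewrite eqEsubv subvf; apply/subvP => z _.
have [x zx] := simple_generated v0 z.
apply/memv_imgP; exists (pelt (u i i) (u i i * x)); first exact: memvf.
by rewrite acthomE peltK ?mem_rideal // rm_actM vi.
Qed.

(** In the kernel the coefficient of the trivial path vanishes because [v] is nonzero, and every
    longer path from [i] starts with the arrow to [i.+1]. *)
Lemma augm_exact : lker augm = limg (pdiff i i.+1).
Proof.
apply/eqP; rewrite eqEsubv; apply/andP; split; apply/subvP => x; last first.
  case/memv_imgP => y _ ->; rewrite memv_ker acthomE pdiffE rm_actM.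
  by rewrite simple_act_path // rm_act0l.
rewrite memv_ker acthomE => /eqP x0.
suff /ridealP[y xy] : pval x \in rideal (u i i.+1).
  apply/memv_imgP; exists (pelt (u i.+1 i.+1) (u i.+1 i.+1 * y)).
    exact: memvf.
  apply: pval_inj; rewrite pdiffE peltK ?mem_rideal //.
  by rewrite mulrA upath_idr.
apply: mem_upath_comp => j jN.
have [k] := upath_corner i j (pval x).
rewrite (rideal_idem (upath_idl A i i) (pvalP x)) => xE; rewrite xE.
have [ij|ji|ij] := ltngtP i j; last 1 first.
- move: (congr1 (fun w => rm_act w (u j j)) x0).
  rewrite -rm_actM xE rm_act0l rm_actZr -ij vi => /eqP.
  by rewrite scaler_eq0 (negbTE v0) orbF => /eqP->; rewrite scale0r mem0v.
- by rewrite -(@upath_cat _ _ A i i.+1 j) ?ij ?leqnSn // scalerAr mem_rideal.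
by rewrite upath_out ?scaler0 ?mem0v // leqNgt ji.
Qed.

Section Sequence.

(** The sequence is abstract because two kinds are used below: a uniform one that serves for lower
    bounds on the projective dimension, and short ones that end in zero modules. *)
Variable a : nat -> nat.
Hypotheses (a0 : a 0%N = i) (a1 : a 1%N = i.+1).
Hypothesis a_mono : forall k, (a k <= a k.+1)%N.
Hypothesis a_exact : forall k,
  minn (g (a k.+1)) (maxn (a k.+1) (g (a k))) = minn (g (a k.+1)) (a k.+2).

Let aug0 : 'Hom(proj_at (a 0%N), S) := acthom (u (a 0%N) (a 0%N)) v.

Fact seq_aug_surj : limg aug0 = fullv.
Proof. by rewrite /aug0 a0 augm_surj. Qed.

Fact seq_aug_exact : lker aug0 = limg (pdiff (a 0%N) (a 1%N)).
Proof. by rewrite /aug0 a0 a1 augm_exact. Qed.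

Fact seq_exact k :
  lker (pdiff (a k) (a k.+1)) = limg (pdiff (a k.+1) (a k.+2)).
Proof. by rewrite (@pdiff_exact _ _ (a k.+2)) // !a_mono. Qed.

Definition path_resolution : presolution S :=
  @PResolution F A S (fun k => proj_at (a k))
    (fun k => pdiff (a k) (a k.+1)) aug0 (fun k => @projective_proj_at (a k))
    (fun k => acthom_hom _ _) (acthom_hom _ _)
    seq_aug_surj seq_aug_exact seq_exact.

Local Notation R := path_resolution.

Lemma path_resolution_pd k : (forall j, (k < j)%N -> a j = N.+1) -> pd_le S k.
Proof.
by move=> ak; exists R => j /ak aj; rewrite /= aj dim_proj_at_out.
Qed.

Lemma path_cocyclesP M k (f : 'Hom(proj_at (a k), M)) :
  reflect (exists m : M, [/\ rm_act m (u (a k) (a k)) = m,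
      f = acthom (u (a k) (a k)) m & rm_act m (u (a k) (a k.+1)) = 0])
    (f \in cocycles R M k).
Proof.
apply: (iffP (@cocyclesP _ _ _ R M k f)) => /= [[/homA_proj_at[m mk ->]]|[m [mk -> md]]].
  rewrite acthom_pdiff => /eqP; rewrite acthom_eq0 ?upath_idl //.
  by rewrite -rm_actM upath_idr => /eqP; exists m.
split; first exact: acthom_hom.
rewrite acthom_pdiff; apply/eqP; rewrite acthom_eq0 ?upath_idl //.
by rewrite md rm_act0l.
Qed.

Lemma path_coboundariesP M k (f : 'Hom(proj_at (a k.+1), M)) :
  reflect (exists2 m : M, rm_act m (u (a k) (a k)) = m &
      f = acthom (u (a k.+1) (a k.+1)) (rm_act m (u (a k) (a k.+1))))
    (f \in coboundaries R M k.+1).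
Proof.
apply: (iffP (@coboundariesP _ _ _ R M k f)) => /=
  [[h /homA_proj_at[m mk ->] ->]|[m mk ->]].
  by exists m => //; rewrite acthom_pdiff.
by exists (acthom (u (a k) (a k)) m); [exact: acthom_hom | rewrite acthom_pdiff].
Qed.

(* The class of the differential, corestricted to its image, in the group     *)
(* Ext^{k+1}(S, u A); all homomorphisms from the previous term to u A vanish. *)
Lemma not_pd_le j k : (j <= k)%N -> (a k < a k.+1 < g (a k))%N -> ~ pd_le S j.
Proof.
move=> jk ak pdj.
have := @pd_le_ext _ _ _ R (prmod (u (a k) (a k.+1))) j k.+1 pdj jk.
set b := a k in ak *; set c := a k.+1 in ak *; set X := prmod _ => /subvP sub.
have ubc : u b c != 0 by rewrite upath_boundE; lia.
pose m : X := pelt _ (u b c).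
have mE : pval m = u b c by rewrite peltK ?rideal_id.
have : acthom (u c c) m \in cocycles R X k.+1.
  apply/path_cocyclesP; exists m; split=> //; apply: pval_inj.
    by rewrite pval_act mE upath_idr.
  rewrite pval_act mE pval0 upath_cat -/c ?a_mono ?(ltnW (andP ak).1) //.
  (* Since [c < g b <= g c], exactness gives [g b <= a k.+2], so the path from [b] to [a k.+2] is
     zero. *)
  apply/eqP; rewrite -[_ == _]negbK upath_boundE.
  have := a_exact k; have := a_mono k.+1; rewrite -/b -/c.
  have : (g b <= g c)%N by apply: bound_mono; lia.
  lia.
move/sub/path_coboundariesP => -[n nb].
suff -> : n = 0.
  move/eqP; rewrite rm_act0l.
  have -> : acthom (u c c) (0 : X) = 0.
    by apply/eqP; rewrite acthom_eq0 ?upath_idl ?rm_act0l.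
  rewrite acthom_eq0 ?upath_idl // => /eqP/(congr1 (@pval _ _ _)).
  by rewrite pval_act mE upath_idr pval0; apply/eqP.
rewrite -nb; apply: pval_inj; rewrite pval_act pval0.
have /ridealP[y ->] := pvalP n.
rewrite -(upath_idr A b c) -!mulrA [X in _ * X]mulrA upath_left0 ?mulr0 //.
by case/andP: ak.
Qed.

(** Hom(S, A) consists of the [y] in [A e_i] killed by the arrow leaving [i]. A path from [j] to [i]
    is such a [y], and nonzero, exactly when [i] is the last vertex reached from [j], that is, when
    [g j = i.+1]. *)
Lemma path_ext0 : ext_dim_eq S regA 0 0 <-> (forall j, g j <> i.+1).
Proof.
rewrite (ext_dim_eqE R) dimv0 subn0; split=> [/eqP|gj].
  rewrite dimv_eq0 => /eqP Z0 j gj.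
  have ji : (j <= i)%N.
    rewrite -ltnS -gj; have [jN|Nj] := leqP j N; last first.
      by have := bound_ge A j; lia.
    by have := upath_boundE A j j; rewrite upath_neq0; lia.
  have uji : u j i != 0 by rewrite upath_boundE; lia.
  have : acthom (u (a 0%N) (a 0%N)) (u j i : regA) \in cocycles R regA 0.
    apply/path_cocyclesP; exists (u j i); rewrite a0 a1 /=.
    split=> //; first by rewrite upath_idr.
    apply/eqP; rewrite upath_cat ?ji ?leqnSn // -[_ == _]negbK upath_boundE.
    by rewrite gj ltnn andbF.
  rewrite Z0 memv0 acthom_eq0 ?upath_idl //= a0 upath_idr.
  by rewrite (negbTE uji).
apply/eqP; rewrite dimv_eq0 -subv0; apply/subvP => f.
case/path_cocyclesP => y [yi -> y0]; rewrite memv0 acthom_eq0 ?upath_idl //.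
rewrite yi; move: yi y0; rewrite a0 a1 /= => yi y0.
rewrite [y]mul_upath_suml big1 // => b _.
have [k yE] := upath_corner b i y.
rewrite -yi mulrA yE; apply/eqP; rewrite scaler_eq0; apply/norP => -[k0 ub].
have /eqP : u b b * y * u i i.+1 = 0 by rewrite -mulrA y0 mulr0.
rewrite -{1}(upath_idl A i i.+1) mulrA yE -scalerAl.
move: (ub); rewrite upath_boundE => /andP[bi ig].
rewrite upath_cat ?bi ?leqnSn // scaler_eq0 (negbTE k0) /=.
by rewrite -[_ == _]negbK upath_boundE; have := gj b; lia.
Qed.

(** A coboundary factors through [A e_(a k)], and no path leads from [d] back to [a k]. This detects
    cocycles that are not coboundaries. *)
Lemma path_cob_coef k d (y : regA) : (a k < d)%N ->
    acthom (u (a k.+1) (a k.+1)) y \in coboundaries R regA k.+1 ->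
  u d d * (y * u (a k.+1) (a k.+1)) = 0.
Proof.
move=> kd /path_coboundariesP[m mk /lfunP/(_ (pgen _))].
rewrite !acthomE /= pval_gen => ->; rewrite -mk /=.
by rewrite -!mulrA 2!mulrA upath_left0 ?mul0r.
Qed.

(** Put [c = a k.+1]. The next term is zero, so the cocycles are all of [A e_c], and the
    coboundaries are the left multiples of the arrow into [c]. The class of [e_c] spans the
    quotient. *)
Lemma path_ext_arrow k : (a k < N)%N -> a k.+1 = (a k).+1 ->
  a k.+2 = N.+1 -> ext_dim_eq S regA k.+1 1.
Proof.
move=> kN ak1 ak2; apply/(ext_dim_eqE R).
pose c := a k.+1; pose z := acthom (u c c) (u c c : regA).
have ucc : u c c != 0 by apply: upath_neq0; rewrite /c; lia.
have zZ : z \in cocycles R regA k.+1.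
  apply/path_cocyclesP; exists (u c c); split=> //=; rewrite ?upath_idl //.
  by rewrite upath_out // ak2 ltnn andbF.
have zB : z \notin coboundaries R regA k.+1.
  apply/negP => /(@path_cob_coef k c); rewrite /c ak1 => /(_ (leqnn _))/eqP.
  by rewrite !upath_idl -ak1 (negbTE ucc).
suff -> : cocycles R regA k.+1 = (coboundaries R regA k.+1 + <[z]>)%VS.
  by rewrite dimv_add_line // subSnn.
apply/eqP; rewrite eqEsubv subv_add coboundaries_sub -memvE zZ !andbT.
apply/subvP => _ /path_cocyclesP[y [yc -> _]].
have [|l [y' yE]] := @arrow_decomp (a k) y kN; first by rewrite -ak1.
apply/memv_addP; exists (acthom (u c c) (y' * u (a k) (a k.+1) : regA)).
  apply/path_coboundariesP; exists (y' * u (a k) (a k)) => /=.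
    by rewrite -mulrA upath_idl.
  by rewrite -mulrA upath_idl.
exists (l *: z); first by rewrite memvZ ?memv_line.
apply/lfunP => x; rewrite add_lfunE scale_lfunE !acthomE /=.
by move: (pval x) => x'; rewrite yE /c ak1 mulrDl scalerAl addrC.
Qed.

(** If the last differential were a path of length at least two into [c], then [e_c] and the arrow
    into [c] would be independent modulo coboundaries, and Ext would have dimension at least two. *)
Lemma path_ext_long k : ext_dim_eq S regA k.+1 1 -> a k.+2 = N.+1 ->
  (a k.+1 <= N)%N -> (a k.+1 <= (a k).+1)%N.
Proof.
move=> /(ext_dim_eqE R) ext1 ak2 kN; rewrite leqNgt; apply/negP => ak1.
pose c := a k.+1.
pose z := acthom (u c c) (u c c : regA).
pose z' := acthom (u c c) (u c.-1 c : regA).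
have ucc : u c c != 0 by apply: upath_neq0; rewrite /c; lia.
have uc1 : u c.-1 c != 0 by apply: upath_neq0; rewrite /c; lia.
have uN b : u b (a k.+2) = 0 by rewrite upath_out // ak2 ltnn andbF.
have zZ : z \in cocycles R regA k.+1.
  apply/path_cocyclesP; exists (u c c); split=> //=; rewrite ?upath_idl //.
have z'Z : z' \in cocycles R regA k.+1.
  apply/path_cocyclesP; exists (u c.-1 c); split=> //=; rewrite ?upath_idr //.
  by rewrite uN mulr0.
set B := coboundaries R regA k.+1 in ext1.
have z'B : z' \notin B.
  have kc : (a k < c.-1)%N by rewrite /c; lia.
  apply/negP => /(path_cob_coef kc)/eqP.
  by rewrite upath_idr upath_idl (negbTE uc1).
have zB : z \notin (B + <[z']>)%VS.
  apply/negP => /memv_addP[w wB [_ /vlineP[l ->] zE]].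
  have : acthom (u c c) (u c c - l *: u c.-1 c : regA) \in B.
    suff -> : acthom (u c c) (u c c - l *: u c.-1 c : regA) = w by [].
    apply/lfunP => x; rewrite acthomE /= mulrBl -scalerAl.
    have -> : w = z - l *: z' by rewrite zE addrK.
    rewrite add_lfunE opp_lfunE scale_lfunE.
    by rewrite [z x](@acthomE _ _ _ regA) [z' x](@acthomE _ _ _ regA).
  move/(@path_cob_coef k c)=> /(_ (ltnW ak1))/eqP.
  rewrite -/c mulrBl -scalerAl !upath_idr mulrBr upath_idl -scalerAr.
  rewrite upath_idl0; last by rewrite /c; lia.
  by rewrite scaler0 subr0 (negbTE ucc).
have : (B + <[z']> + <[z]> <= cocycles R regA k.+1)%VS.
  by rewrite !subv_add -!memvE zZ z'Z coboundaries_sub.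
move/dimvS; rewrite !dimv_add_line //; move: ext1.
by move: (\dim _) (\dim _); lia.
Qed.

(** A cocycle is [l e_(i+1)] plus a left multiple of the arrow into [i.+1]. The path from [i.+1] to
    [g i] kills the arrow part but, as [g i < g i.+1], not [e_(i+1)]; so [l = 0] and a coboundary
    remains. *)
Lemma path_ext1 : a 2%N = g i -> (g i < g i.+1)%N -> ext_dim_eq S regA 1 0.
Proof.
move=> a2 gi; apply/(ext_dim_eqE R)/eqP; rewrite subn_eq0; apply: dimvS.
apply/subvP => _ /path_cocyclesP[y [yc -> y0]]; move: y0; rewrite a2 => y0.
have [|l [y' yE]] := @arrow_decomp i y iN; first by rewrite -a1.
apply/path_coboundariesP; exists (y' * u i i) => /=.
  by rewrite a0 -mulrA upath_idl.
rewrite a0 a1; suff l0 : l = 0.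
  by rewrite yE l0 scale0r add0r -mulrA upath_idl.
have gi2 := bound_ge2 A iN.
have : u i.+1 i.+1 * (y * u i.+1 (g i)) = 0.
  by move: y0; rewrite a1 /= => ->; rewrite mulr0.
rewrite yE mulrDl mulrDr -mulrA upath_cat; last by lia.
have -> : u i (g i) = 0.
  by apply/eqP; rewrite -[_ == _]negbK upath_boundE ltnn andbF.
rewrite !mulr0 addr0 -scalerAl -scalerAr !upath_idl => /eqP.
rewrite scaler_eq0 -[u _ _ == 0]negbK upath_boundE gi.
by rewrite (ltnW gi2) orbF => /eqP.
Qed.

End Sequence.

End Resolution.

End NakayamaModules.

(** * Regularity of a simple module in terms of [bound] *)

Section Regularity.

Variables (F : fieldType) (N : nat) (A : lnakayama F N).
Variables (i : 'I_N.+1) (S : rmodule A).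
Hypotheses (iN : (i < N)%N) (Si : simple_at i S).

Local Notation u := (upath A).
Local Notation g := (bound A).
Local Notation regA := (regular_rmodule A).

Lemma simple_at_vector :
  exists2 v : S, rm_act v (u i i) = v & v != 0.
Proof.
case: Si => _ [w /eqP wi]; exists (rm_act w (u i i)).
  by rewrite -rm_actM upath_idl.
by rewrite -idem_upath.
Qed.

Let g_mono := @bound_mono F N A.
Let gi2 := bound_ge2 A iN.

(* This resolution is exact even where it is not minimal, hence needs no case *)
(* distinction on the projective dimension.                                   *)
Definition syz_seq k : nat :=
  (iter k (fun p : nat * nat => (p.2, g p.1)) (i : nat, i.+1)).1.

Lemma syz_seqS k : syz_seq k.+2 = g (syz_seq k).
Proof. by rewrite /syz_seq !iterS. Qed.

Lemma syz_seq_bounds k : (syz_seq k <= syz_seq k.+1 <= g (syz_seq k))%N.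
Proof.
elim: k => [|k]; first by rewrite /syz_seq /=; lia.
by case/andP => kk1 k1g; rewrite syz_seqS k1g g_mono.
Qed.

Lemma syz_seq_exact k :
  minn (g (syz_seq k.+1)) (maxn (syz_seq k.+1) (g (syz_seq k))) =
  minn (g (syz_seq k.+1)) (syz_seq k.+2).
Proof. by have := syz_seq_bounds k; rewrite syz_seqS; lia. Qed.

(** The default [N.+1] of [nth] stands for zero modules. With [c = N.+1] the resolution has length
    one; [c = g i] or [c = i.+2] is used for length two. *)
Definition short_seq c k : nat := nth N.+1 [:: i : nat; i.+1; c] k.

Lemma short_seq_mono c k : (i < c <= N.+1)%N ->
  (short_seq c k <= short_seq c k.+1)%N.
Proof.
by case: k => [|[|[|k]]] ic; rewrite /short_seq /= ?nth_nil; lia.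
Qed.

(** The first hypothesis is exactness at [proj_at i.+1], the second is injectivity of the map out of
    [proj_at c]. *)
Lemma short_seq_exact c k :
    minn (g i.+1) (g i) = minn (g i.+1) c -> (g c <= maxn c (g i.+1))%N ->
    (i < c <= N.+1)%N ->
  minn (g (short_seq c k.+1)) (maxn (short_seq c k.+1) (g (short_seq c k))) =
  minn (g (short_seq c k.+1)) (short_seq c k.+2).
Proof.
move=> gE gc cN; have := bound_max A; have := @bound_le _ _ A c.
by case: k => [|[|[|k]]]; rewrite /short_seq /= ?nth_nil; lia.
Qed.

(** [not_pd_le] applies to the uniform resolution at [k = 0], where [i < i.+1 < g i], and at
    [k = 1], where [i.+1 < g i < g i.+1]. *)
Lemma not_pd_le_bound : ~ pd_le S 0 /\ (g i != g i.+1 -> ~ pd_le S 1).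
Proof.
have [v vi v0] := simple_at_vector; case: (Si) => simpleS _.
have npd := not_pd_le iN simpleS vi v0 (erefl : syz_seq 0 = i)
  (erefl : syz_seq 1 = i.+1) (fun k => (andP (syz_seq_bounds k)).1) syz_seq_exact.
split; first by apply: (npd 0%N 0%N) => //; rewrite /syz_seq /=; lia.
move=> gi1; apply: (npd 1%N 1%N) => //; rewrite /syz_seq /=.
by have := g_mono (leqnSn i); lia.
Qed.

(** Otherwise [g i < g i.+1 < g (g i)], and [not_pd_le] at [k = 2] gives a contradiction. *)
Lemma pd_le2_bound : pd_le S 2 -> g i != g i.+1 -> g (g i) = g i.+1.
Proof.
have [v vi v0] := simple_at_vector; case: (Si) => simpleS _.
have npd := not_pd_le iN simpleS vi v0 (erefl : syz_seq 0 = i)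
  (erefl : syz_seq 1 = i.+1) (fun k => (andP (syz_seq_bounds k)).1) syz_seq_exact.
move=> pd2 gi1; have [//|ggi] := eqVneq (g (g i)) (g i.+1).
case: (npd 2%N 2%N _ _ pd2) => //; rewrite /syz_seq /=.
have := g_mono (leqnSn i); have := @g_mono i.+1 (g i); lia.
Qed.

(** Projective dimension one amounts to the equality of bounds, which lets the resolution stop at
    [e_(i+1) A]; the omitted value is the vanishing of Hom(S, A). Then Ext^1 is one-dimensional
    since the differential is an arrow. *)
Lemma regular1P :
  k_regular 1 S <-> g i = g i.+1 /\ forall j, g j <> i.+1.
Proof.
have [v vi v0] := simple_at_vector; case: (Si) => simpleS _.
have gN := @bound_le _ _ A i.+1.
have cN : (i < N.+1 <= N.+1)%N by lia.
have gmax := bound_max A.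
split=> [[_ [pd1 _] ext0 _]|[gE gj]].
  have gE : g i = g i.+1.
    by apply/eqP/negPn/negP => /(not_pd_le_bound.2).
  split=> //; apply/(path_ext0 iN simpleS vi v0 (erefl : short_seq N.+1 0 = i)
    (erefl : short_seq N.+1 1 = i.+1) (fun k => short_seq_mono k cN)).
    by move=> k; apply: short_seq_exact => //; lia.
  exact: ext0.
have ex k : minn (g (short_seq N.+1 k.+1))
    (maxn (short_seq N.+1 k.+1) (g (short_seq N.+1 k))) =
    minn (g (short_seq N.+1 k.+1)) (short_seq N.+1 k.+2).
  by apply: short_seq_exact => //; lia.
have a0 : short_seq N.+1 0 = i by [].
have a1 : short_seq N.+1 1 = i.+1 by [].
have mono k := @short_seq_mono N.+1 k cN.
split=> //.
- split=> [|j]; last by case: j => // _; apply: not_pd_le_bound.1.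
  apply: (path_resolution_pd simpleS vi v0 a0 a1 mono ex).
  by case=> [|[|[|j]]] //=; rewrite /short_seq /= nth_nil.
- by case=> // _; apply/(path_ext0 iN simpleS vi v0 a0 a1 mono ex).
exact: (path_ext_arrow iN simpleS vi v0 a0 a1 mono ex (k := 0%N)).
Qed.

(** Projective dimension two gives a resolution ending at [e_(g i) A], and [path_ext_long] forces
    its last differential to be an arrow, so [g i = i.+2]. Conversely, [path_ext1] makes Ext^1
    vanish. *)
Lemma regular2P :
  k_regular 2 S <->
  [/\ g i = i.+2, forall j, g j <> i.+1, g i.+1 <> g i & g i.+2 = g i.+1].
Proof.
have [v vi v0] := simple_at_vector; case: (Si) => simpleS _.
have gN := @bound_le _ _ A i.+1.
have gmax := bound_max A.
have gi1 := g_mono (leqnSn i).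
split=> [[_ [pd2 npd] ext0 ext2]|[gi gj gne gE]].
  have gne : g i <> g i.+1.
    move=> gE; apply: (npd 1%N isT).
    have cN : (i < N.+1 <= N.+1)%N by lia.
    apply: (path_resolution_pd simpleS vi v0 (erefl : short_seq N.+1 0 = i)
      (erefl : short_seq N.+1 1 = i.+1) (fun k => short_seq_mono k cN)).
      by move=> k; apply: short_seq_exact => //; lia.
    by case=> [|[|[|j]]] //=; rewrite /short_seq /= nth_nil.
  have ggi : g (g i) = g i.+1 by apply: pd_le2_bound => //; apply/eqP.
  have cN : (i < g i <= N.+1)%N by lia.
  have a0 : short_seq (g i) 0 = i by [].
  have a1 : short_seq (g i) 1 = i.+1 by [].
  have mono k := @short_seq_mono (g i) k cN.
  have ex k : minn (g (short_seq (g i) k.+1))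
      (maxn (short_seq (g i) k.+1) (g (short_seq (g i) k))) =
      minn (g (short_seq (g i) k.+1)) (short_seq (g i) k.+2).
    by apply: short_seq_exact => //; lia.
  have gi : g i = i.+2.
    have := path_ext_long iN simpleS vi v0 a0 a1 mono ex (k := 1%N) ext2.
    by rewrite /short_seq /=; lia.
  split=> //; [|by move/esym|by rewrite -ggi gi].
  by apply/(path_ext0 iN simpleS vi v0 a0 a1 mono ex); apply: ext0.
have cN : (i < i.+2 <= N.+1)%N by lia.
have a0 : short_seq i.+2 0 = i by [].
have a1 : short_seq i.+2 1 = i.+1 by [].
have mono k := @short_seq_mono i.+2 k cN.
have ex k : minn (g (short_seq i.+2 k.+1))
    (maxn (short_seq i.+2 k.+1) (g (short_seq i.+2 k))) =
    minn (g (short_seq i.+2 k.+1)) (short_seq i.+2 k.+2).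
  by apply: short_seq_exact => //; lia.
split=> //.
- split=> [|[|[|//]] _]; last 2 first.
  + exact: not_pd_le_bound.1.
  + by apply: not_pd_le_bound.2; apply/eqP => /esym.
  apply: (path_resolution_pd simpleS vi v0 a0 a1 mono ex).
  by case=> [|[|[|j]]] //=; rewrite /short_seq /= nth_nil.
- case=> [|[|//]] _; first by apply/(path_ext0 iN simpleS vi v0 a0 a1 mono ex).
  by apply: (path_ext1 iN simpleS vi v0 a0 a1 mono ex); rewrite ?gi //; lia.
apply: (path_ext_arrow iN simpleS vi v0 a0 a1 mono ex (k := 1%N)) => //.
by rewrite /short_seq /=; lia.
Qed.

End Regularity.

(* Translation between bounds and heights of the path *)
Local Close Scope ring_scope.

Theorem theorem3p10 (F : fieldType) (N : nat) (A : lnakayama F N)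
    (D E : lattice_path) (hD : is_dyck_path_of A D) (hE : is_LK N D E)
    (i : 'I_N.+1) (hi : (i < N)%N) (S : rmodule A) (hS : simple_at i S) :
  (k_regular 1 S <-> has_1cut E i) /\ (k_regular 2 S <-> has_2hill E i).
Proof.
case: hD => DN areaD; pose g := bound A; pose h k := (g k).-1.
have g_gt k : k <= N -> k < g k.
  by rewrite leq_eqVlt => /orP[/eqP ->|/(bound_ge2 A)/ltnW //]; rewrite /g bound_last.
have g_le k : k <= N.+1 -> g k <= N.+1 by apply: bound_le.
have h_mono k l : k <= l -> h k <= h l.
  by move=> /(bound_mono A); rewrite /h /g; lia.
have h_gt k : k < N -> k < h k by move/(bound_ge2 A); rewrite /h /g; lia.
have N_gt0 : 0 < N by lia.
have h_pred : h N.-1 = N.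
  by have := h_gt N.-1; have := g_le N.-1; rewrite /h; lia.
have h_last : h N = N by rewrite /h /g bound_last.
have hD k : k < N -> height D k = h k.
  move=> kN; have kN' : k < N.+1 by apply: ltnW.
  have := areaD (Ordinal kN'); have := kupischE A (Ordinal kN').
  (* The Kupisch number is at least two here, so the truncated subtraction in [area] is exact and
     the height is [(g k).-1]. *)
  by have := bound_ge2 A kN; rewrite /area /h /g /=; lia.
have valE : (forall j, g j <> i.+1) <-> forall k, k < N -> h k <> i.
  split=> [gj k kN hk|hk j gj].
    by apply: (gj k); have := g_gt k; move: hk; rewrite /h; lia.
  (* For [j >= N] the bound [g j] is at least [N.+1], hence larger than [i.+1]. *)
  have jN : j < N.
    rewrite ltnNge leq_eqVlt; apply/negP => /orP[/eqP jE|Nj].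
      by move: gj; rewrite -jE /g bound_last; lia.
    by have := bound_ge A j; rewrite -/g gj; lia.
  by apply: (hk j jN); rewrite /h gj.
rewrite (cut_LK h_mono h_gt N_gt0 h_pred h_last DN hD hE hi).
rewrite (hill_LK h_mono h_gt N_gt0 h_pred h_last DN hD hE hi).
rewrite (regular1P hi hS) (regular2P hi hS) -/g.
have g0 := g_gt i (ltnW hi); have g1 := g_gt i.+1 hi.
have g2 : 0 < g i.+2 by have := bound_ge A i.+2; rewrite -/g; lia.
split; split.
- by case=> gE /valE; rewrite /h gE.
- by case=> hE1 /valE gj; split=> //; move: hE1; rewrite /h; lia.
- by case=> gi /valE hk gne gE; split=> //; rewrite /h; lia.
by case=> hi1 /valE gj hne hE1; split=> //; move: hi1 hne hE1; rewrite /h; lia.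
Qed.
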